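(* Let $l\in\{0,1\}$. Suppose the randomized classifiers $\{Q_i\}$ have the form $Q_i(x)=g(x,\mathcal{D},\xi_i)$ (for all $x\in\mathcal{X}$) with $g$ deterministic and $\xi_1,\xi_2,\dots$ i.i.d. and independent of $\mathcal{D}$. Suppose also that for each $l'\in\{0,1\}$ the conditional distribution $\mathcal{L}(\theta(X)\mid\mathcal{D},Y=l')$ has a density $f_{l'}$ on $[0,1]$ that is Lipschitz in a neighborhood of $1/2$. Let $[1/2-\delta_l,1/2+\delta_l]$, with $\delta_l\in(0,1/2)$, be a neighborhood on which $f_l$ is Lipschitz. Let $\hat f_{l}(\tfrac12)$ be the hold-out estimator computed with the rectangular kernel $K(s)=\frac12 1\{-1\le s\le1\}$, bandwidth $h$, $m_l$ hold-out points, and $t$ classifiers ($t$ odd). Then there are numbers $c_1,c_2>0$ not depending on $t$ or $m_l$ such that, if the bandwidth is set to $h=c_1(\min\{m_l,\sqrt t\})^{-1/3}$, then as soon as $h<\delta_l$, $$\mathbb{E}\big[(\hat f_{l}(\tfrac12)-f_l(\tfrac12))^2\mid\mathcal{D}\big]\;\le\;c_2\,\big(\min\{m_l,\sqrt t\}\big)^{-2/3}.$$ Furthermore, if the derivative $f_l'$ is also Lipschitz on $[1/2-\delta_l,1/2+\delta_l]$, then there are numbers $c_1,c_2>0$ not depending on $t$ or $m_l$ such that, if the bandwidth is set to $h=c_1(\min\{m_l,\sqrt t\})^{-1/5}$, then as soon as $h<\delta_l$, $$\mathbb{E}\big[(\hat f_{l}(\tfrac12)-f_l(\tfrac12))^2\mid\mathcal{D}\big]\;\le\;c_2\,\big(\min\{m_l,\sqrt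 t\}\big)^{-4/5}.$$
   Context: $\mathcal{X}$ is a generic sample space; $\mathcal{D}=\{(X_j,Y_j)\}_{j=1}^n$ is a training set in $\mathcal{X}\times\{0,1\}$, which is held fixed (constants may depend on $\mathcal{D}$). $(X,Y)$ is a random test point in $\mathcal{X}\times\{0,1\}$, independent of $\mathcal{D}$ and of $\xi_1,\xi_2,\dots$. The classifiers are random functions $Q_i:\mathcal{X}\to\{0,1\}$, $\bar Q_t(x):=\frac1t\sum_{i=1}^tQ_i(x)$. Define $\theta:\mathcal{X}\to[0,1]$ by $\theta(x):=\mathbb{E}[Q_1(x)\mid\mathcal{D}]$, the expectation being over $\xi_1$ with $x$ and $\mathcal{D}$ fixed. The hold-out points $\tilde X_{1,l},\dots,\tilde X_{m_l,l}$ are i.i.d. with distribution $\mathcal{L}(X\mid Y=l)$, independent of $\mathcal{D}$, of the ensemble $\{Q_i\}$, and of $(X,Y)$. The hold-out estimator of $f_l(\tfrac12)$ with kernel $K$ and bandwidth $h>0$ is $$\hat f_{l}(\tfrac12):=\frac{1}{m_lh}\sum_{j=1}^{m_l}K\Big(\frac{1/2-\bar Q_t(\tilde X_{j,l})}{h}\Big).$$ The expectation $\mathbb{E}[\cdot\mid\mathcal{D}]$ is over both the hold-out points and the randomizing variables $\{\xi_i\}$. A function $q:[0,1]\to\mathbb{R}$ is Lipschitz in a neighborhood of $1/2$ if there are constants $\kappa,\delta>0$ with $|q(s)-q(s')|\le\kappa|s-s'|$ for all $s,s'\in[1/2-\delta,1/2+\delta]$. *)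

(* Defs.v *)
From HB Require Import structures.
From mathcomp Require Import all_boot all_order all_algebra.
From mathcomp Require Import all_classical all_reals all_analysis.

Set Implicit Arguments.
Unset Strict Implicit.
Unset Printing Implicit Defensive.

Import Order.TTheory GRing.Theory Num.Theory.
Import numFieldNormedType.Exports.

Local Open Scope classical_set_scope.
Local Open Scope ring_scope.

(* Labels and votes in {0,1} are booleans, false being 0.  The training set is
   a fixed tuple on which the classifiers depend, so that expectations and laws
   given the training set are plain expectations and laws under P. *)

Section Independence.
Context (R : realType) (d : measure_display) (Omega : measurableType d)
  (P : probability Omega R).

(* Mutual independence of an arbitrary family of set systems (in practice, of
   the sigma-algebras generated by random elements). *)
Definition mutually_independent (I : choiceType)
    (F : I -> set_system Omega) : Prop :=
  forall (s : seq I) (A : I -> set Omega), uniq s ->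
    (forall i, i \in s -> F i (A i)) ->
    P (\bigcap_(i in [set` s]) A i) = (\prod_(i <- s) P (A i))%E.

Definition join_family (I J : choiceType) (F : I -> set_system Omega)
    (G : J -> set_system Omega) : I + J -> set_system Omega :=
  fun k => match k with inl i => F i | inr j => G j end.

Definition cond_prob (A B : set Omega) : \bar R := (P (A `&` B) / P B)%E.

End Independence.

Section Ensemble.
Context (R : realType) (d : measure_display) (Omega : measurableType d)
  (P : probability Omega R) (dX : measure_display) (Xsp : measurableType dX).

(* [Q i w x] is the vote at x of the classifier usually written Q_{i+1}: the
   sequence starts at index 0, so the common mean [theta] is that of [Q 0]. *)
Definition theta (Q : nat -> Omega -> Xsp -> bool) (x : Xsp) : R :=
  fine 'E_P[fun w => (Q 0%N w x)%:R].

Definition vote_avg (Q : nat -> Omega -> Xsp -> bool) (t : nat)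
    (w : Omega) (x : Xsp) : R :=
  t%:R^-1 * \sum_(i < t) (Q i w x)%:R.

Definition holdout_estimator (K : R -> R) (h : R)
    (Q : nat -> Omega -> Xsp -> bool) (t m : nat) (Xt : 'I_m -> Omega -> Xsp)
    (w : Omega) : R :=
  (m%:R * h)^-1 * \sum_(j < m) K ((2^-1 - vote_avg Q t w (Xt j w)) / h).

End Ensemble.

Definition rect_kernel (R : realType) (s : R) : R :=
  2^-1 * \1_(`[-1, 1]%classic : set R) s.

(* Densities on [0,1] are total functions; their values elsewhere are unused. *)
Definition has_density01 (R : realType) (mu : set R -> \bar R)
    (f : R -> R) : Prop :=
  [/\ measurable_fun (`[0, 1]%classic : set R) f,
      forall s, 0 <= s <= 1 -> 0 <= f s &
      forall B : set R, measurable B ->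
        mu B = (\int[lebesgue_measure]_(s in B `&` `[0%R, 1%R]%classic)
                  (f s)%:E)%E].

Definition half_nbhd (R : realType) (delta : R) : set R :=
  `[2^-1 - delta, 2^-1 + delta]%classic.

Definition is_lipschitz_on (R : realType) (A : set R) (q : R -> R) : Prop :=
  exists2 kappa : R, 0 < kappa & kappa.-lipschitz_A q.

Definition rate_scale (R : realType) (m t : nat) : R :=
  Num.min m%:R (Num.sqrt t%:R).

Section HoldOutSample.
Context (R : realType) (d : measure_display) (Omega : measurableType d)
  (P : probability Omega R)
  (dX : measure_display) (Xsp : measurableType dX)
  (dXi : measure_display) (Xi : measurableType dXi).

(* Independence of the ensemble is independence of the randomizing variables xi:
   independence of the values Q_i(x), x fixed, would not determine the law of
   the votes at a hold-out point.  Mutual independence of the hold-out points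
   is contained in each of the two joint statements. *)
Definition holdout_sample (X : {RV P >-> Xsp}) (Y : {RV P >-> bool})
    (xi : nat -> {RV P >-> Xi}) (l : bool) (m : nat)
    (Xt : 'I_m -> {RV P >-> Xsp}) : Prop :=
  [/\ forall j B, measurable B ->
        distribution P (Xt j) B
        = cond_prob P (X @^-1` B) (Y @^-1` [set l]),
      mutually_independent P
        (join_family (fun i : nat => g_sigma_algebra_preimage (xi i))
                     (fun j : 'I_m => g_sigma_algebra_preimage (Xt j))) &
      mutually_independent P
        (join_family
           (fun _ : unit => g_sigma_algebra_preimage (fun w => (X w, Y w)))
           (fun j : 'I_m => g_sigma_algebra_preimage (Xt j)))].

End HoldOutSample.

(* Main.v *)
Require Import Defs.
From HB Require Import structures.
From mathcomp Require Import all_boot all_order all_algebra.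
From mathcomp Require Import all_classical all_reals all_analysis.
From mathcomp Require Import measurable_realfun zify ring lra.
Set Implicit Arguments.
Unset Strict Implicit.
Unset Printing Implicit Defensive.
Import Order.TTheory GRing.Theory Num.Theory.
Import numFieldNormedType.Exports.
Local Open Scope classical_set_scope.
Local Open Scope ring_scope.

(** Write [N] for [rate_scale], [th_j] for [theta] at the hold-out point [X_j]
    and [v_j] for the vote average there.  Compare the estimator with the oracle
    that puts [th_j] in the place of [v_j].

    The oracle is a kernel density estimator built on independent observations
    of density [f].  Its bias is at most [kappa * h ^+ beta], with [beta = 1] if
    [f] is Lipschitz and [beta = 2] if its derivative is; its variance is of
    order [1 / (m * h)], because a window of half-width [h] has probability of
    order [h].  With [h] of order [N `^ (- (1 / (2 * beta + 1)))] both squared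
    contributions are of the announced order.

    The two estimators differ only through the points where [v_j] and [th_j]
    disagree about lying in the window, and a disagreement forces [v_j - th_j]
    to exceed the distance from [th_j] to the nearest edge of the window.  All
    the points share the same votes, so disagreements at two points are
    dependent, and the mean square of the difference is governed by the
    probability that two given points disagree together, since the terms with a
    single point carry a factor [1 / m].  Bounding it by the
    probability of one disagreement, of order [t `^ (- (1 / 2))], would be too
    weak after the division by [h ^+ 2].  The pairs are therefore sorted by
    three scales, with [s = t `^ (- (1 / 6))]:
    - both [th_j] and [th_k] lie within [s ^+ 2] of an edge: the points are
      independent and the density is bounded, so this has probability of order
      [s ^+ 4];
    - both lie within [s], an event of probability of order [s ^+ 2], but one of
      them is farther than [s ^+ 2]: Chebyshev's inequality adds the factor
      [(t * s ^+ 4)^-1 = s ^+ 2];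
    - one of them is farther than [s]: Chebyshev's inequality alone gives
      [(t * s ^+ 2)^-1 = s ^+ 4].
    Hence two points disagree together with probability of order [s ^+ 4], that
    is [t `^ (- (2 / 3))], which is at most [N `^ (- (4 / 3))] and negligible in
    both regimes.

    In the second case Chebyshev's inequality is used on an event that depends
    on both points: [Exp_vote_avg_sqr] bounds the second moment of [v_j - th_j]
    on such an event by [1 / t] times its probability.  It holds because, once
    the two points and one vote are fixed, another vote is centered at [th_j],
    so that cross terms vanish by Fubini's theorem ([Exp_vote_cross0]).  The
    probabilistic estimates are collected in [holdout_mse_le], the powers of [N]
    are compared in [rate_comparison], and both claims are instances of
    [holdout_rate]. *)

(** * Expectations of bounded measurable functions *)

Section BoundedExpectation.
Context (R : realType) (d : measure_display) (T : measurableType d)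
  (P : probability T R).
Implicit Types (F G : T -> R).

(** Such functions are stable under the algebraic operations and integrable for
    every probability measure, which makes the real-valued expectation linear
    and monotone on them without further side conditions. *)
Definition bounded_mfun F : Prop :=
  measurable_fun setT F /\ exists M, forall w, `|F w| <= M.

Lemma bounded_mfun_integrable F :
  bounded_mfun F -> P.-integrable setT (EFin \o F).
Proof.
move=> [mF [M FM]]; apply: measurable_bounded_integrable => //.
  by apply: le_lt_trans (probability_le1 P measurableT) _; rewrite ltry.
exists M; split; first exact: num_real.
by move=> N MN w _; apply: (le_trans (FM w)); exact: ltW.
Qed.

Lemma bounded_mfun_cst c : bounded_mfun (fun=> c).
Proof. by split; [exact: measurable_cst|exists `|c|]. Qed.

Lemma bounded_mfunD F G :
  bounded_mfun F -> bounded_mfun G -> bounded_mfun (fun w => F w + G w).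
Proof.
move=> [mF [M FM]] [mG [N GN]]; split; first exact: measurable_funD.
by exists (M + N) => w; apply: le_trans (ler_normD _ _) _; exact: lerD.
Qed.

Lemma bounded_mfunM F G :
  bounded_mfun F -> bounded_mfun G -> bounded_mfun (fun w => F w * G w).
Proof.
move=> [mF [M FM]] [mG [N GN]]; split; first exact: measurable_funM.
by exists (M * N) => w; rewrite normrM; exact: ler_pM.
Qed.

Lemma bounded_mfunB F G :
  bounded_mfun F -> bounded_mfun G -> bounded_mfun (fun w => F w - G w).
Proof.
move=> bF bG; have -> : (fun w => F w - G w) = (fun w => F w + -1 * G w).
  by apply/funext => w; rewrite mulN1r.
apply: bounded_mfunD => //; apply: bounded_mfunM => //.
exact: bounded_mfun_cst.
Qed.

Lemma bounded_mfunX F n : bounded_mfun F -> bounded_mfun (fun w => F w ^+ n).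
Proof.
move=> bF; elim: n => [|n IH]; first exact: bounded_mfun_cst.
have -> : (fun w => F w ^+ n.+1) = (fun w => F w * F w ^+ n).
  by apply/funext => w; rewrite exprS.
exact: bounded_mfunM.
Qed.

Lemma bounded_mfun_sum (I : Type) (s : seq I) (F : I -> T -> R) :
  (forall i, bounded_mfun (F i)) -> bounded_mfun (fun w => \sum_(i <- s) F i w).
Proof.
move=> bF; elim: s => [|i s IH].
  by under eq_fun do rewrite big_nil; exact: bounded_mfun_cst.
by under eq_fun do rewrite big_cons; exact: bounded_mfunD.
Qed.

Lemma bounded_mfun_bool (b : T -> bool) :
  measurable_fun setT b -> bounded_mfun (fun w => (b w)%:R).
Proof.
move=> mb; split; last first.
  by exists 1 => w; case: (b w); rewrite /= ?normr1 ?normr0.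
have -> : (fun w => (b w)%:R) = (fun w => if b w then 1 else 0) :> (T -> R).
  by apply/funext => w; case: (b w).
exact: measurable_fun_ifT.
Qed.

Lemma ExpD F G : bounded_mfun F -> bounded_mfun G ->
  \int[P]_w (F w + G w) = \int[P]_w F w + \int[P]_w G w.
Proof.
by move=> bF bG; rewrite RintegralD//; exact: bounded_mfun_integrable.
Qed.

Lemma ExpZ c F : bounded_mfun F -> \int[P]_w (c * F w) = c * \int[P]_w F w.
Proof. by move=> bF; rewrite RintegralZl//; exact: bounded_mfun_integrable. Qed.

Lemma Exp_cst c : \int[P]_w c = c.
Proof. by rewrite Rintegral_cst//= (@probability_setT _ _ _ P) mulr1. Qed.

Lemma Exp_sum (I : Type) (s : seq I) (F : I -> T -> R) :
  (forall i, bounded_mfun (F i)) ->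
  \int[P]_w (\sum_(i <- s) F i w) = \sum_(i <- s) \int[P]_w F i w.
Proof.
move=> bF; elim: s => [|i s IH].
  rewrite big_nil -[RHS](Exp_cst 0).
  by apply: eq_Rintegral => w _; rewrite big_nil.
rewrite big_cons -IH -ExpD//; last exact: bounded_mfun_sum.
by apply: eq_Rintegral => w _; rewrite big_cons.
Qed.

Lemma le_Exp F G : bounded_mfun F -> bounded_mfun G ->
  (forall w, F w <= G w) -> \int[P]_w F w <= \int[P]_w G w.
Proof.
by move=> bF bG FG; apply: le_Rintegral => //; exact: bounded_mfun_integrable.
Qed.

Lemma Exp_bool (b : T -> bool) : measurable_fun setT b ->
  \int[P]_w (b w)%:R = fine (P [set w | b w]).
Proof.
move=> mb.
have mB : measurable [set w | b w].
  by have := mb measurableT [set true] I; rewrite setTI.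
rewrite /Rintegral -(setIT [set w | b w]) -integral_indic//.
congr fine; apply: eq_integral => w _; rewrite indicE; congr (_%:R%:E).
by congr nat_of_bool; apply/idP/idP; rewrite inE.
Qed.

Lemma expectation_bounded F :
  bounded_mfun F -> ('E_P[F])%E = (\int[P]_w F w)%:E.
Proof.
move=> bF; rewrite unlock /Rintegral fineK//.
by apply: integrable_fin_num => //; exact: bounded_mfun_integrable.
Qed.

(** Expanding the square separates the [m ^+ 2] mixed products from the [m]
    squares.  It serves for independent centered terms, where [K = 0], and for
    dependent terms, where [K] is much smaller than [L]. *)
Lemma Exp_sqr_sum_le (m : nat) (F : 'I_m -> T -> R) (K L : R) :
  (forall j, bounded_mfun (F j)) ->
  (forall j k, j != k -> \int[P]_w (F j w * F k w) <= K) ->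
  (forall j, \int[P]_w (F j w ^+ 2) <= L) -> 0 <= K ->
  \int[P]_w ((\sum_(j < m) F j w) ^+ 2) <= m%:R ^+ 2 * K + m%:R * L.
Proof.
move=> bF FK FL K0.
have -> : (fun w => (\sum_(j < m) F j w) ^+ 2) =
    (fun w => \sum_(j < m) \sum_(k < m) F j w * F k w).
  apply/funext => w; rewrite expr2 mulr_suml; apply: eq_bigr => j _.
  by rewrite mulr_sumr.
rewrite Exp_sum; last first.
  by move=> j; apply: bounded_mfun_sum => k; exact: bounded_mfunM.
apply: (@le_trans _ _ (\sum_(j < m) (m%:R * K + L))); last first.
  rewrite sumr_const card_ord -[_ *+ m]mulr_natl mulrDr mulrA -expr2; lra.
apply: ler_sum => j _; rewrite Exp_sum; last by move=> k; exact: bounded_mfunM.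
rewrite (bigD1 j)//= addrC; apply: lerD; last exact: FL.
apply: (@le_trans _ _ (\sum_(k < m | k != j) K)).
  by apply: ler_sum => k kj; apply: FK; rewrite eq_sym.
rewrite sumr_const -[_ *+ _]mulr_natl ler_wpM2r// ler_nat.
by rewrite (leq_trans (max_card _))// card_ord.
Qed.

End BoundedExpectation.

Lemma bounded_mfun_comp (R : realType) (d1 d2 : measure_display)
    (T1 : measurableType d1) (T2 : measurableType d2)
    (F : T2 -> R) (U : T1 -> T2) :
  bounded_mfun F -> measurable_fun setT U -> bounded_mfun (fun w => F (U w)).
Proof.
move=> [mF [M FM]] mU; split; first exact: (measurableT_comp mF).
by exists M => w; exact: FM.
Qed.

(** * Joint laws and vanishing expectations *)

Section JointLaws.
Context (R : realType) (d : measure_display) (T : measurableType d)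
  (P : probability T R).

(** Both sides are finite measures in [S], and the rectangles that the
    hypothesis concerns are stable under intersection and generate the product
    sigma-algebra.  Independence of random elements taken one at a time is
    thereby transferred to their joint law. *)
Lemma indep_event_pair (d1 d2 : measure_display) (T1 : measurableType d1)
    (T2 : measurableType d2) (U : T -> T1) (V : T -> T2) (E : set T) :
  measurable_fun setT U -> measurable_fun setT V -> measurable E ->
  (forall A B, measurable A -> measurable B ->
     P (U @^-1` A `&` V @^-1` B `&` E)
     = (P (U @^-1` A `&` V @^-1` B) * P E)%E) ->
  forall S, measurable S ->
    P ((fun w => (U w, V w)) @^-1` S `&` E)
    = (P ((fun w => (U w, V w)) @^-1` S) * P E)%E.
Proof.
move=> mU mV mE UVE S mS.
have mUV : measurable_fun setT (fun w => (U w, V w)).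
  exact: measurable_fun_pair.
pose W w := (U w, V w).
have PEfin : P E \is a fin_num by exact: fin_num_measure.
pose r : {nonneg R} := NngNum (fine_ge0 (measure_ge0 P E)).
pose m1_ : {measure set (T1 * T2)%type -> \bar R} :=
  pushforward (mrestr P mE) W.
pose m2_ : {measure set (T1 * T2)%type -> \bar R} :=
  mscale r (pushforward P W).
pose m1 := m1_ mUV; pose m2 := m2_ mUV.
rewrite [LHS](_ : _ = m1 S)//.
rewrite [RHS](_ : _ = m2 S); last first.
  by rewrite /m2 /m2_ /= /mscale /= fineK// muleC.
pose G : set (set (T1 * T2)) :=
  [set C | exists A, measurable A /\ exists B, measurable B /\ C = A `*` B].
apply: (measure_unique G (fun=> setT)) => //.
- rewrite measurable_prod_measurableType //; congr (<<s _ >>).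
  rewrite predeqE; split => [[A mA [B mB <-]]|[A [mA [B [mB ->]]]]].
    by exists A; split => //; exists B.
  by exists A => //; exists B.
- move=> /= _ _ [X1 [mX1 [X2 [mX2 ->]]]] [Y1 [mY1 [Y2 [mY2 ->]]]].
  rewrite -setXI; exists (X1 `&` Y1); split; first exact: measurableI.
  by exists (X2 `&` Y2); split => //; exact: measurableI.
- by move=> _; exists setT; split=> //; exists setT; split=> //; rewrite setXTT.
- by apply: bigcup_const; exists 0%N.
- move=> _ [A [mA [B [mB ->]]]].
  by rewrite /m2 /m2_ /= /mscale /= fineK// muleC -UVE.
- move=> _; rewrite [ltLHS](_ : _ = P (W @^-1` setT `&` E))//.
  rewrite preimage_setT setTI.
  by apply: le_lt_trans (probability_le1 P mE) _; rewrite ltry.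
Qed.

(** By independence the law of the pair is a product measure, and Fubini's
    theorem integrates over the second coordinate first. *)
Lemma Exp_indep_inner0 (d1 d2 : measure_display) (T1 : measurableType d1)
    (T2 : measurableType d2) (W : T -> T1) (V : T -> T2) (F : T1 * T2 -> R) :
  measurable_fun setT W -> measurable_fun setT V ->
  (forall A B, measurable A -> measurable B ->
     P (W @^-1` A `&` V @^-1` B) = (P (W @^-1` A) * P (V @^-1` B))%E) ->
  bounded_mfun F -> (forall x, \int[P]_w F (x, V w) = 0) ->
  \int[P]_w F (W w, V w) = 0.
Proof.
move=> mW mV WVE [mF [M FM]] F0.
have mWV : measurable_fun setT (fun w => (W w, V w)).
  exact: measurable_fun_pair.
pose W' : {mfun T >-> T1} := mfun_Sub (mem_set mW).
pose V' : {mfun T >-> T2} := mfun_Sub (mem_set mV).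
pose U : {mfun T >-> (T1 * T2)%type} := mfun_Sub (mem_set mWV).
have prodE S : measurable S ->
    (distribution P W' \x distribution P V')%E S = distribution P U S.
  by apply: product_measure_unique => A B mA mB; exact: WVE.
have iF : P.-integrable setT ((EFin \o F) \o U).
  apply: (@bounded_mfun_integrable _ _ _ P (F \o U)); split.
    exact: measurableT_comp.
  by exists M => w; exact: FM.
rewrite /Rintegral -[0]/(fine 0%E); congr fine.
transitivity (\int[distribution P U]_z (F z)%:E)%E.
  by rewrite integral_distribution//; exact/measurable_EFinP.
transitivity (\int[distribution P W' \x distribution P V']_z (F z)%:E)%E.
  by apply: eq_measure_integral => S mS _; apply/esym; exact: prodE.
rewrite -integral12_prod_meas1; last first.
  apply: (@bounded_mfun_integrable _ _ _
    (distribution P W' \x distribution P V')%E).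
  by split => //; exists M.
apply: integral0_eq => x _; rewrite /fubini_F.
have bx : bounded_mfun (fun w => F (x, V w)).
  split; last by exists M.
  by apply: (measurableT_comp mF); exact: measurable_fun_pair.
transitivity (\int[P]_w (F (x, V w))%:E)%E.
  rewrite (@integral_distribution _ _ _ _ _ _ V' (fun y => (F (x, y))%:E))//.
    apply/measurable_EFinP; apply: (measurableT_comp mF).
    exact: pair1_measurable.
  exact: (bounded_mfun_integrable P bx).
rewrite -[LHS]fineK; first by rewrite -/(Rintegral _ _ _) F0.
by apply: integrable_fin_num => //; exact: (bounded_mfun_integrable P bx).
Qed.

End JointLaws.

Section SampleIndependence.
Context (R : realType) (d : measure_display) (Omega : measurableType d)
  (P : probability Omega R)
  (dX : measure_display) (Xsp : measurableType dX)
  (dXi : measure_display) (Xi : measurableType dXi)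
  (xi : nat -> {RV P >-> Xi}) (m : nat) (Xt : 'I_m -> {RV P >-> Xsp}).
Hypothesis indep : mutually_independent P
  (join_family (fun i : nat => g_sigma_algebra_preimage (xi i))
               (fun j : 'I_m => g_sigma_algebra_preimage (Xt j))).

Let sigma_preimage d' (T' : measurableType d') (F : Omega -> T') B :
  measurable B -> g_sigma_algebra_preimage F (F @^-1` B).
Proof. by move=> mB; exists B => //; rewrite setTI. Qed.

Lemma points_indep j k B1 B2 : j != k -> measurable B1 -> measurable B2 ->
  P (Xt j @^-1` B1 `&` Xt k @^-1` B2)
  = (P (Xt j @^-1` B1) * P (Xt k @^-1` B2))%E.
Proof.
move=> jk mB1 mB2.
pose A (z : nat + 'I_m) := match z with
  | inl _ => setT
  | inr v => if v == j then Xt j @^-1` B1 else Xt k @^-1` B2 end.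
have := @indep [:: inr j; inr k] A.
rewrite bigcap_seq !big_cons !big_nil /= eqxx eq_sym (negPf jk) setIT mule1.
apply.
  by rewrite /= inE andbT; apply: contra jk => /eqP[->].
move=> z; rewrite !inE => /orP[]/eqP->; rewrite /= ?eqxx.
  exact: sigma_preimage.
by rewrite eq_sym (negPf jk); exact: sigma_preimage.
Qed.

(** The two points may coincide, in which case both events on them are merged
    into a single one; this case gives the second moment of the vote average at
    one point without any restriction to an event ([Exp_vote_avg_sqrT]). *)
Lemma points_votes_product j k i i' B1 B2 C C' : i != i' ->
  measurable B1 -> measurable B2 -> measurable C -> measurable C' ->
  P ((Xt j @^-1` B1 `&` Xt k @^-1` B2) `&` (xi i @^-1` C `&` xi i' @^-1` C'))
  = (P (Xt j @^-1` B1 `&` Xt k @^-1` B2)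
     * (P (xi i @^-1` C) * P (xi i' @^-1` C')))%E.
Proof.
move=> ii' mB1 mB2 mC mC'.
have i'i : (i' == i) = false by rewrite eq_sym (negPf ii').
have [<-|jk] := eqVneq j k.
  pose A (z : nat + 'I_m) := match z with
    | inl u => if u == i then xi i @^-1` C else xi i' @^-1` C'
    | inr _ => Xt j @^-1` (B1 `&` B2) end.
  have := @indep [:: inr j; inl i; inl i'] A.
  rewrite bigcap_seq !big_cons !big_nil /= eqxx i'i setIT mule1.
  apply.
    by rewrite /= !inE andbT/=; apply: contra ii' => /eqP[->].
  move=> z; rewrite !inE => /or3P[]/eqP->; rewrite /= ?eqxx ?i'i;
    apply: sigma_preimage => //; exact: measurableI.
have kj : (k == j) = false by rewrite eq_sym (negPf jk).
pose A (z : nat + 'I_m) := match z with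
  | inl u => if u == i then xi i @^-1` C else xi i' @^-1` C'
  | inr v => if v == j then Xt j @^-1` B1 else Xt k @^-1` B2 end.
have := @indep [:: inr j; inr k; inl i; inl i'] A.
rewrite bigcap_seq !big_cons !big_nil /= !eqxx i'i kj setIT mule1.
rewrite points_indep// -muleA -setIA.
apply.
  rewrite /= !inE !andbT/=; apply/andP; split.
    by rewrite orbF; apply: contra jk => /eqP[->].
  by apply: contra ii' => /eqP[->].
by move=> z; rewrite !inE => /or4P[]/eqP->; rewrite /= ?eqxx ?i'i ?kj;
  exact: sigma_preimage.
Qed.

End SampleIndependence.

(** * Second moment of the vote average *)

Section VoteAverage.
Context (R : realType) (d : measure_display) (Omega : measurableType d)
  (P : probability Omega R)
  (dX : measure_display) (Xsp : measurableType dX)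
  (dXi : measure_display) (Xi : measurableType dXi)
  (q : Xsp -> Xi -> bool) (xi : nat -> {RV P >-> Xi}).
Hypothesis mq : measurable_fun setT (fun p : Xsp * Xi => q p.1 p.2).
Hypothesis xi_id : forall i B, measurable B ->
  distribution P (xi i) B = distribution P (xi 0%N) B.

Let Q i w x := q x (xi i w).

Lemma measurable_votes (x : Xsp) : measurable_fun setT (q x).
Proof. exact: (measurableT_comp mq (pair1_measurable x)). Qed.

(** The votes have the same law, so the mean of the first one is that of all. *)
Lemma Exp_vote i x : \int[P]_w (Q i w x)%:R = theta P Q x.
Proof.
have mqx j : measurable_fun setT (fun w => Q j w x).
  exact: (measurableT_comp (measurable_votes x)).
rewrite /theta expectation_bounded/=; last exact: bounded_mfun_bool.
rewrite !Exp_bool//.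
have mS : measurable [set e | q x e].
  by have := @measurable_votes x measurableT [set true] I; rewrite setTI.
by have := xi_id i mS; rewrite /distribution /pushforward => /(congr1 fine).
Qed.

Lemma theta_ge0 x : 0 <= theta P Q x.
Proof. by rewrite -(Exp_vote 0); apply: Rintegral_ge0. Qed.

Lemma theta_le1 x : theta P Q x <= 1.
Proof.
rewrite -(Exp_vote 0) -[leRHS](Exp_cst P); apply: le_Exp.
- by apply: bounded_mfun_bool; exact: (measurableT_comp (measurable_votes x)).
- exact: bounded_mfun_cst.
- by move=> w; case: (Q 0 w x).
Qed.

(** [theta] is a partial integral of a jointly measurable function. *)
Lemma measurable_theta : measurable_fun setT (theta P Q).
Proof.
have [mF _] := bounded_mfun_bool R mq.
have -> : theta P Q = fine \o
    fubini_F (distribution P (xi 0%N))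
      (fun p : Xsp * Xi => ((q p.1 p.2)%:R : R)%:E).
  apply/funext => x /=; rewrite -(Exp_vote 0) /Rintegral /fubini_F /=.
  rewrite ge0_integral_distribution//.
  apply/measurable_EFinP; exact: (measurableT_comp mF (pair1_measurable x)).
apply: measurableT_comp; first exact: fine_measurable.
apply: measurable_fun_fubini_tonelli_F; last by move=> p; rewrite lee_fin.
exact/measurable_EFinP.
Qed.

Lemma bounded_theta : bounded_mfun (theta P Q).
Proof.
split; first exact: measurable_theta.
by exists 1 => x; rewrite ger0_norm ?theta_ge0// theta_le1.
Qed.

Lemma bounded_centered_vote i (X1 : {RV P >-> Xsp}) :
  bounded_mfun (fun w => (Q i w (X1 w))%:R - theta P Q (X1 w)).
Proof.
apply: bounded_mfunB; last exact: bounded_mfun_comp bounded_theta _.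
apply: bounded_mfun_bool.
exact: (measurableT_comp mq
  (measurable_fun_pair (measurable_funPT X1) (measurable_funPT (xi i)))).
Qed.

Lemma bounded_vote_avg t (X1 : {RV P >-> Xsp}) :
  bounded_mfun (fun w => vote_avg R Q t w (X1 w)).
Proof.
apply: bounded_mfunM; first exact: bounded_mfun_cst.
apply: bounded_mfun_sum => i; apply: bounded_mfun_bool.
exact: (measurableT_comp mq
  (measurable_fun_pair (measurable_funPT X1) (measurable_funPT (xi i)))).
Qed.

Section TwoPoints.
Context (X1 X2 : {RV P >-> Xsp}).
Hypothesis indep : forall i i' B1 B2 C C', i != i' ->
  measurable B1 -> measurable B2 -> measurable C -> measurable C' ->
  P ((X1 @^-1` B1 `&` X2 @^-1` B2) `&` (xi i @^-1` C `&` xi i' @^-1` C'))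
  = (P (X1 @^-1` B1 `&` X2 @^-1` B2)
     * (P (xi i @^-1` C) * P (xi i' @^-1` C')))%E.

(** The pairing step is applied first to the two points, jointly against the
    two votes, and then to these points and the first vote, against the second
    vote. *)
Lemma points_votes_indep i i' S C : i != i' -> measurable S -> measurable C ->
  P ((fun w => ((X1 w, X2 w), xi i w)) @^-1` S `&` xi i' @^-1` C)
  = (P ((fun w => ((X1 w, X2 w), xi i w)) @^-1` S) * P (xi i' @^-1` C))%E.
Proof.
move=> ii' mS mC.
have mX : measurable_fun setT (fun w => (X1 w, X2 w)).
  exact: measurable_fun_pair.
have mxi k B : measurable B -> measurable (xi k @^-1` B).
  by move=> mB; exact: measurable_funPTI.
have PT Y : P ((Y : Omega -> Xsp) @^-1` setT) = 1%E.
  by rewrite preimage_setT probability_setT.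
have xi2 B B' : measurable B -> measurable B' ->
    P (xi i @^-1` B `&` xi i' @^-1` B')
    = (P (xi i @^-1` B) * P (xi i' @^-1` B'))%E.
  move=> mB mB'; have := indep ii' measurableT measurableT mB mB'.
  by rewrite !preimage_setT !setTI (@probability_setT _ _ _ P) mul1e.
have X12 A B B' : measurable A -> measurable B -> measurable B' ->
    P ((fun w => (X1 w, X2 w)) @^-1` A `&` (xi i @^-1` B `&` xi i' @^-1` B'))
    = (P ((fun w => (X1 w, X2 w)) @^-1` A)
       * (P (xi i @^-1` B) * P (xi i' @^-1` B')))%E.
  move=> mA mB mB'; rewrite -xi2//; apply: indep_event_pair => //.
    by apply: measurableI; exact: mxi.
  by move=> B1 B2 mB1 mB2; rewrite indep// xi2.
apply: indep_event_pair => //; first exact: mxi.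
move=> A B mA mB; rewrite -setIA X12// muleA; congr (_ * _)%E.
have := X12 A B setT mA mB measurableT.
by rewrite !preimage_setT !setIT (@probability_setT _ _ _ P) mule1.
Qed.

(** Once the points and the vote [i] are fixed, the last factor has mean zero
    over the vote [i'].  The weight may depend on the second point, although the
    votes are taken at the first one. *)
Lemma Exp_vote_cross0 i i' (phi : Xsp * Xsp -> R) : i != i' ->
  bounded_mfun phi ->
  \int[P]_w (phi (X1 w, X2 w) * ((Q i w (X1 w))%:R - theta P Q (X1 w))
             * ((Q i' w (X1 w))%:R - theta P Q (X1 w))) = 0.
Proof.
move=> ii' bphi.
pose F (p : (Xsp * Xsp * Xi) * Xi) : R :=
  phi p.1.1 * ((q p.1.1.1 p.1.2)%:R - theta P Q p.1.1.1)
  * ((q p.1.1.1 p.2)%:R - theta P Q p.1.1.1).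
have mX : measurable_fun setT (fun w => (X1 w, X2 w)).
  exact: measurable_fun_pair.
have m1 : measurable_fun setT (fun p : (Xsp * Xsp * Xi) * Xi => p.1.1.1).
  apply: (measurableT_comp measurable_fst).
  exact: (measurableT_comp measurable_fst).
have m2 : measurable_fun setT (fun p : (Xsp * Xsp * Xi) * Xi => p.1.2).
  exact: (measurableT_comp measurable_snd).
apply: (@Exp_indep_inner0 _ _ _ P _ _ _ _
  (fun w => ((X1 w, X2 w), xi i w)) (xi i') F) => //.
- exact: measurable_fun_pair.
- by move=> A B mA mB; exact: points_votes_indep.
- apply: bounded_mfunM; first apply: bounded_mfunM.
  + apply: bounded_mfun_comp => //.
    exact: (measurableT_comp measurable_fst).
  + apply: bounded_mfunB; last exact: bounded_mfun_comp bounded_theta _.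
    apply: bounded_mfun_bool.
    exact: (measurableT_comp mq (measurable_fun_pair m1 m2)).
  + apply: bounded_mfunB; last exact: bounded_mfun_comp bounded_theta _.
    apply: bounded_mfun_bool.
    exact: (measurableT_comp mq (measurable_fun_pair m1 measurable_snd)).
- move=> [[x x'] e]; rewrite /F/=.
  have bv : bounded_mfun (fun w => (q x (xi i' w))%:R : R).
    by apply: bounded_mfun_bool; exact: (measurableT_comp (measurable_votes x)).
  rewrite ExpZ; last by apply: bounded_mfunB => //; exact: bounded_mfun_cst.
  rewrite ExpD//; last exact: bounded_mfun_cst.
  by rewrite Exp_cst Exp_vote subrr mulr0.
Qed.

(** The variance of a mean of [t] uncorrelated votes, which stays valid on an
    event that depends on both points: the cross terms vanish there too, and a
    centered vote is at most [1] in absolute value. *)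
Lemma Exp_vote_avg_sqr t (phi : Xsp * Xsp -> bool) : (0 < t)%N ->
  measurable_fun setT phi ->
  \int[P]_w ((phi (X1 w, X2 w))%:R
             * (vote_avg R Q t w (X1 w) - theta P Q (X1 w)) ^+ 2)
  <= t%:R^-1 * \int[P]_w (phi (X1 w, X2 w))%:R.
Proof.
move=> t0 mphi.
have tR : (t%:R : R) != 0 by rewrite pnatr_eq0 -lt0n.
have mX : measurable_fun setT (fun w => (X1 w, X2 w)).
  exact: measurable_fun_pair.
have bphi : bounded_mfun (fun p => (phi p)%:R : R) by exact: bounded_mfun_bool.
have bphiX : bounded_mfun (fun w => (phi (X1 w, X2 w))%:R : R).
  exact: bounded_mfun_comp bphi _.
pose F (i : 'I_t) w : R :=
  (phi (X1 w, X2 w))%:R * ((Q i w (X1 w))%:R - theta P Q (X1 w)).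
have bF i : bounded_mfun (F i).
  by apply: bounded_mfunM => //; exact: bounded_centered_vote.
have -> : (fun w => (phi (X1 w, X2 w))%:R
    * (vote_avg R Q t w (X1 w) - theta P Q (X1 w)) ^+ 2)
    = (fun w => t%:R ^- 2 * (\sum_(i < t) F i w) ^+ 2).
  apply/funext => w; rewrite /F -mulr_sumr.
  rewrite sumrB sumr_const card_ord -[theta _ _ _ *+ t]mulr_natr /vote_avg.
  set S := \sum_(_ < _) _; set b : R := (phi _)%:R.
  have bb : b ^+ 2 = b by rewrite /b; case: (phi _); rewrite ?expr1n ?expr0n.
  by rewrite [(b * _) ^+ 2]exprMn bb [RHS]mulrCA; congr (b * _); field.
rewrite ExpZ; last by apply: bounded_mfunX; exact: bounded_mfun_sum.
have := @Exp_sqr_sum_le _ _ _ P t F 0 (\int[P]_w (phi (X1 w, X2 w))%:R) bF.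
rewrite mulr0 add0r => H.
rewrite (_ : t%:R^-1 = t%:R ^- 2 * t%:R); last by rewrite expr2 invfM mulfVK.
rewrite -mulrA ler_wpM2l ?invr_ge0 ?exprn_ge0 ?ler0n//.
apply: H => // [i i' ii'|i].
- rewrite le_eqVlt; apply/orP; left; apply/eqP.
  rewrite -[RHS](@Exp_vote_cross0 i i' (fun p => (phi p)%:R))//.
  apply: eq_Rintegral => w _; rewrite /F.
  by case: (phi _); rewrite ?mul0r ?mul1r.
- apply: le_Exp => //; first exact: bounded_mfunX.
  move=> w; rewrite /F; case: (phi _); rewrite ?mul0r ?expr0n// mul1r.
  have := theta_ge0 (X1 w); have := theta_le1 (X1 w).
  by case: (Q i w (X1 w)) => /= h1 h0; nra.
Qed.

End TwoPoints.
End VoteAverage.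

(** * Densities near one half *)

Section DensityNearHalf.
Context (R : realType).
Notation leb := (@lebesgue_measure R).

Lemma lipschitzP (A : set R) (k : R) (q : R -> R) : k.-lipschitz_A q ->
  forall x y, A x -> A y -> `|q x - q y| <= k * `|x - y|.
Proof. by move=> H x y Ax Ay; have := H (x, y); apply. Qed.

(** The odd part of the affine function cancels over a symmetric interval. *)
Lemma Rintegral_affine (A B c h : R) : 0 < h ->
  \int[leb]_(s in `[c - h, c + h]%classic) (A + B * (s - c)) = 2 * h * A.
Proof.
move=> h0.
pose F s : R := A * s + B / 2 * (s - c) ^+ 2.
have dF (s : R) : is_derive s 1 F (A + B * (s - c)).
  rewrite /F; apply: is_derive_eq.
  rewrite /GRing.scale/=; lra.
have cF (s : R) : {for s, continuous F}.
  apply/differentiable_continuous/derivable1_diffP.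
  by have [] := dF s.
rewrite /Rintegral (@continuous_FTC2 R (fun s => A + B * (s - c)) F)//.
- by rewrite /= /F; field; lra.
- lra.
- apply: continuous_subspaceT => s.
  apply: cvgD; first exact: cvg_cst.
  apply: cvgM; first exact: cvg_cst.
  by apply: cvgB; [exact: cvg_id|exact: cvg_cst].
- split => [s _||]; first by have [] := dF s.
  + by apply: cvg_at_right_filter; exact: cF.
  + by apply: cvg_at_left_filter; exact: cF.
- by move=> s _; rewrite derive1E; have [] := dF s.
Qed.

Lemma integrable_bounded_itv (a b : R) (f : R -> R) (M : R) :
  measurable_fun (`[a, b]%classic : set R) f ->
  (forall s, s \in `[a, b] -> `|f s| <= M) ->
  leb.-integrable (`[a, b]%classic : set R) (EFin \o f).
Proof.
move=> mf fM; apply: measurable_bounded_integrable => //.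
  rewrite /= lebesgue_measure_itv/=; case: ifP => // _.
  by rewrite -EFinB ltry.
exists M; split; first exact: num_real.
by move=> N MN s abs; apply: (le_trans (fM s abs)); exact: ltW.
Qed.

Variables (mu : set R -> \bar R) (f : R -> R).
Hypothesis mu_f : has_density01 mu f.

Lemma density_itv (a b : R) : 0 <= a -> b <= 1 ->
  mu `[a, b]%classic = (\int[leb]_(s in `[a, b]) (f s)%:E)%E.
Proof.
move=> a0 b1; have [_ _ ->//] := mu_f.
congr (integral _ _ _); apply/seteqP; split=> s /=; rewrite !in_itv/=.
  by case.
by move=> /andP[sa sb]; rewrite sa sb; split => //; apply/andP; split; lra.
Qed.

Lemma measurable_density_itv (a b : R) : 0 <= a -> b <= 1 ->
  measurable_fun (`[a, b]%classic : set R) f.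
Proof.
move=> a0 b1; have [mf _ _] := mu_f.
apply: measurable_funS mf => //= s /=; rewrite !in_itv/= => /andP[sa sb].
by apply/andP; split; lra.
Qed.

Lemma density_itv_le (a b M : R) : 0 <= a -> a <= b -> b <= 1 ->
  (forall s, s \in `[a, b] -> f s <= M) ->
  (mu `[a, b]%classic <= (M * (b - a))%:E)%E.
Proof.
move=> a0 ab b1 fM; rewrite density_itv//.
have f0 s : s \in `[a, b] -> 0 <= f s.
  rewrite in_itv/= => /andP[sa sb]; have [_ + _] := mu_f; apply.
  by apply/andP; split; lra.
apply: (@le_trans _ _ (\int[leb]_(s in `[a, b]) M%:E)%E).
  apply: ge0_le_integral => //=.
  - by apply/measurable_EFinP; exact: measurable_density_itv.
rewrite integral_cst//= lebesgue_measure_itv/= lte_fin; case: ltP => ab'.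
  by rewrite -EFinB -EFinM.
have -> : b = a by lra.
by rewrite subrr mulr0 mule0.
Qed.

(** The bias bound: the mean of [f] over the window is compared with its value
    at the center.  The slope [B] is free, as it does not contribute to the
    mean; it is [0] for a Lipschitz density and the derivative at the center
    for a smoother one, which improves the error [e] from order [h] to order
    [h ^+ 2]. *)
Lemma density_window (A B c h e : R) : 0 < h -> 0 <= c - h -> c + h <= 1 ->
  (forall s, s \in `[c - h, c + h] -> `|f s - (A + B * (s - c))| <= e) ->
  `|fine (mu `[c - h, c + h]%classic) / (2 * h) - A| <= e.
Proof.
move=> h0 ch0 ch1 fe.
rewrite density_itv// -/(Rintegral _ _ _).
have mA : measurable_fun (`[c - h, c + h]%classic : set R)
    (fun s => A + B * (s - c)).
  apply: measurable_funTS; apply: measurable_funD => //.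
  by apply: measurable_funM => //; apply: measurable_funB.
have bA s : s \in `[c - h, c + h] -> `|A + B * (s - c)| <= `|A| + `|B| * h.
  rewrite in_itv/= => /andP[s1 s2].
  apply: le_trans (ler_normD _ _) _; rewrite lerD2l normrM ler_wpM2l//.
  by rewrite ler_norml; apply/andP; split; lra.
have iA := integrable_bounded_itv mA bA.
have mf := measurable_density_itv ch0 ch1.
have bf s : s \in `[c - h, c + h] -> `|f s| <= e + (`|A| + `|B| * h).
  move=> sI; have -> : f s = (f s - (A + B * (s - c))) + (A + B * (s - c)).
    by rewrite subrK.
  by apply: le_trans (ler_normD _ _) _; apply: lerD; [exact: fe|exact: bA].
have if_ := integrable_bounded_itv mf bf.
have iB : leb.-integrable (`[c - h, c + h]%classic : set R)
    (EFin \o (fun s => f s - (A + B * (s - c)))).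
  by apply: (@integrable_bounded_itv _ _ _ e) => //; exact: measurable_funB.
have H : \int[leb]_(s in `[c - h, c + h]%classic) f s - 2 * h * A =
    \int[leb]_(s in `[c - h, c + h]%classic) (f s - (A + B * (s - c))).
  by rewrite RintegralB// Rintegral_affine.
have lebI : fine (leb (`[c - h, c + h]%classic : set R)) = 2 * h.
  rewrite lebesgue_measure_itv/= lte_fin ifT; last lra.
  by rewrite -EFinB /=; lra.
have e2h : `|\int[leb]_(s in `[c - h, c + h]%classic) f s - 2 * h * A|
    <= e * (2 * h).
  rewrite H; apply: le_trans (le_normr_Rintegral _ _) _ => //.
  rewrite -[leRHS](_ : \int[leb]_(s in `[c - h, c + h]%classic) e = _).
    apply: le_Rintegral => //.
      exact: (integrable_norm iB).
    apply: (@integrable_bounded_itv _ _ _ `|e|) => //.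
  by rewrite Rintegral_cst// lebI.
have h2 : 0 < 2 * h by lra.
set I := Rintegral _ _ _ in e2h *.
have -> : I / (2 * h) - A = (I - 2 * h * A) / (2 * h) by field; lra.
by rewrite normrM normfV (gtr0_norm h2) ler_pdivrMr.
Qed.

End DensityNearHalf.

Section Taylor.
Context (R : realType).

(** By the mean value theorem the increment of [f] is the derivative at an
    intermediate point, which is no farther from [c] than [s] is. *)
Lemma taylor1_lipschitz (f : R -> R) (delta k c s : R) : 0 < k ->
  (forall x, c - delta <= x <= c + delta -> derivable f x 1) ->
  (forall x, c - delta <= x <= c + delta ->
     `|derive1 f x - derive1 f c| <= k * `|x - c|) ->
  c - delta <= s <= c + delta ->
  `|f s - (f c + derive1 f c * (s - c))| <= k * (s - c) ^+ 2.
Proof.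
move=> k0 df lf sI.
have key a b : a <= b -> c - delta <= a -> b <= c + delta ->
    exists2 x, x \in `[a, b] & f b - f a = derive1 f x * (b - a).
  move=> ab a1 b1; apply: MVT_segment => //.
    move=> x; rewrite in_itv/= => /andP[xa xb]; apply: DeriveDef.
      by apply: df; apply/andP; split; lra.
    by rewrite derive1E.
  apply: derivable_within_continuous => x; rewrite in_itv/= => /andP[xa xb].
  by apply: df; apply/andP; split; lra.
have [x [x1 x2 fE]] : exists x, [/\ c - delta <= x <= c + delta,
    `|x - c| <= `|s - c| & f s - f c = derive1 f x * (s - c)].
  case/andP: sI => s1 s2; have [cs|sc] := leP c s.
    have [x xI E] := key c s cs ltac:(lra) s2; exists x.
    move: xI; rewrite in_itv/= => /andP[? ?]; split => //.
      by apply/andP; split; lra.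
    by rewrite !ger0_norm; lra.
  have [x xI E] := key s c (ltW sc) s1 ltac:(lra); exists x.
  move: xI; rewrite in_itv/= => /andP[? ?]; split => //.
      by apply/andP; split; lra.
    by rewrite !ler0_norm; lra.
  by rewrite -opprB E -mulrN opprB.
have -> : f s - (f c + derive1 f c * (s - c)) =
    (derive1 f x - derive1 f c) * (s - c) by rewrite mulrBl -fE; lra.
rewrite normrM -[(s - c) ^+ 2]real_normK ?num_real// expr2 mulrA.
apply: ler_pM => //; apply: le_trans (lf x x1) _.
by rewrite ler_wpM2l// ltW.
Qed.

End Taylor.

(** * Disagreements about the window *)

Section Window.
Context (R : realType).
Implicit Types (h s q th : R).

Definition in_window h s : bool := `|2^-1 - s| <= h.

(** The edges of the window are [2^-1 - h] and [2^-1 + h]. *)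
Definition near_edge h (eta : R) s : bool := `| `|2^-1 - s| - h| < eta.

Lemma rect_kernel_window h s : 0 < h ->
  rect_kernel ((2^-1 - s) / h) = 2^-1 * (in_window h s)%:R.
Proof.
move=> h0; rewrite /rect_kernel indicE; congr (_ * _%:R); congr nat_of_bool.
have E : ((2^-1 - s) / h \in (`[-1, 1]%classic : set R)) =
   (-1 <= (2^-1 - s) / h <= 1).
  by apply/idP/idP; rewrite inE /= in_itv.
by rewrite E ler_pdivlMr// ler_pdivrMr// mulN1r mul1r -ler_norml.
Qed.

(** The distance to one half is a contraction, and the distances of [q] and [th]
    lie on both sides of [h]. *)
Lemma window_disagree h q th (a : R) : in_window h q != in_window h th ->
  near_edge h a th || (a <= `|q - th|).
Proof.
rewrite /in_window /near_edge => H.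
have e : `| `|2^-1 - q| - `|2^-1 - th| | <= `|q - th|.
  rewrite [leRHS]distrC.
  have -> : th - q = (2^-1 - q) - (2^-1 - th) by lra.
  exact: ler_dist_dist.
have [//|/= un] := ltP.
apply: le_trans un _; apply: le_trans e.
move: H; move: `|2^-1 - q| `|2^-1 - th| => x y.
have [h1|h1] := leP x h; have [h2|h2] := leP y h => // _.
  by rewrite gtr0_norm ?ltr0_norm; lra.
by rewrite ler0_norm ?gtr0_norm; lra.
Qed.

(** The pointwise form of Chebyshev's inequality, outside the event [n]. *)
Lemma bool_le_chebyshev (b n : bool) (a z : R) : 0 < a ->
  (b -> n || (a <= `|z|)) -> (b%:R : R) <= n%:R + a ^- 2 * z ^+ 2.
Proof.
move=> a0; case: b => [/(_ isT)|_]; last first.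
  by rewrite addr_ge0// mulr_ge0 ?invr_ge0 ?sqr_ge0.
case/orP => [->|az].
  by rewrite lerDl mulr_ge0 ?invr_ge0 ?sqr_ge0.
have : 1 <= a ^- 2 * z ^+ 2.
  rewrite ler_pdivlMl ?exprn_gt0// mulr1 -(@real_normK _ z) ?num_real//.
  by rewrite ler_pXn2r ?nnegrE// ltW.
by move/le_trans; apply; rewrite lerDr.
Qed.

(** The three scales of the argument.  If both [th] and [th'] are within [a1] of
    an edge, the first term is [1].  Otherwise a point farther than [a1] makes
    its deviation at least [a1], and the middle terms reach [1] when both are
    within [a2].  Otherwise some deviation is at least [a2].  The indicator in
    the middle terms keeps both points close to the edges; bounding each point
    separately would lose this factor. *)
Lemma two_disagreements_le h (q th q' th' a1 a2 : R) : 0 < a1 -> 0 < a2 ->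
  ((in_window h q != in_window h th)
     && (in_window h q' != in_window h th'))%:R <=
  (near_edge h a1 th && near_edge h a1 th')%:R
  + a1 ^- 2 * ((near_edge h a2 th && near_edge h a2 th')%:R * (q - th) ^+ 2)
  + a1 ^- 2 * ((near_edge h a2 th' && near_edge h a2 th)%:R * (q' - th') ^+ 2)
  + (a2 ^- 2 * (q - th) ^+ 2 + a2 ^- 2 * (q' - th') ^+ 2).
Proof.
move=> a10 a20; rewrite [near_edge h a2 th' && _]andbC.
have g0 a x : 0 < a -> (0 : R) <= a ^- 2 * x ^+ 2.
  by move=> a0; rewrite mulr_ge0 ?invr_ge0 ?sqr_ge0.
have big a x : 0 < a -> a <= `|x| -> (1 : R) <= a ^- 2 * x ^+ 2.
  by move=> a0 ax; have := @bool_le_chebyshev true false a x a0 (fun=> ax);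
     rewrite add0r.
have := g0 a1 (q - th) a10; have := g0 a1 (q' - th') a10.
have := g0 a2 (q - th) a20; have := g0 a2 (q' - th') a20.
case: (boolP (in_window h q != in_window h th)) => [d1|_]; last first.
  case: (near_edge h a1 th && _); case: (near_edge h a2 th && _);
  rewrite /= ?mul1r ?mul0r ?mulr0; lra.
case: (boolP (in_window h q' != in_window h th')) => [d2|_]; last first.
  case: (near_edge h a1 th && _); case: (near_edge h a2 th && _);
  rewrite /= ?mul1r ?mul0r ?mulr0; lra.
have e1 := window_disagree a1 d1; have e1' := window_disagree a1 d2.
have e2 := window_disagree a2 d1; have e2' := window_disagree a2 d2.
have [n1|n1] := boolP (near_edge h a1 th && near_edge h a1 th').
  case: (near_edge h a2 th && _); rewrite /= ?mul1r ?mul0r ?mulr0; lra.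
have [n2|n2] := boolP (near_edge h a2 th && near_edge h a2 th').
  have : (1 <= a1 ^- 2 * (q - th) ^+ 2) || (1 <= a1 ^- 2 * (q' - th') ^+ 2).
    move: n1; rewrite negb_and => /orP[/negPf n|/negPf n].
      by rewrite big//; move: e1; rewrite n.
    by rewrite orbC big//; move: e1'; rewrite n.
  by move=> /orP[]; rewrite /= !mul1r; lra.
have : (1 <= a2 ^- 2 * (q - th) ^+ 2) || (1 <= a2 ^- 2 * (q' - th') ^+ 2).
  move: n2; rewrite negb_and => /orP[/negPf n|/negPf n].
    by rewrite big//; move: e2; rewrite n.
  by rewrite orbC big//; move: e2'; rewrite n.
by move=> /orP[]; rewrite /= !mul0r !mulr0; lra.
Qed.

Lemma measurable_in_window h d (T : measurableType d) (F : T -> R) :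
  measurable_fun setT F -> measurable_fun setT (fun x => in_window h (F x)).
Proof.
move=> mF; apply: measurable_fun_ler => //.
apply: (measurableT_comp (@normr_measurable R setT)).
exact: measurable_funB.
Qed.

Lemma measurable_near_edge h a d (T : measurableType d) (F : T -> R) :
  measurable_fun setT F -> measurable_fun setT (fun x => near_edge h a (F x)).
Proof.
move=> mF; apply: measurable_fun_ltr => //.
apply: (measurableT_comp (@normr_measurable R setT)).
apply: measurable_funB => //.
apply: (measurableT_comp (@normr_measurable R setT)).
exact: measurable_funB.
Qed.

End Window.

(** * Mean squared error at fixed bandwidth *)

Section MeanSquaredError.
Context (R : realType) (d : measure_display) (Omega : measurableType d)
  (P : probability Omega R)
  (dX : measure_display) (Xsp : measurableType dX)
  (dXi : measure_display) (Xi : measurableType dXi)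
  (q : Xsp -> Xi -> bool) (xi : nat -> {RV P >-> Xi})
  (m : nat) (Xt : 'I_m -> {RV P >-> Xsp}).
Hypothesis mq : measurable_fun setT (fun p : Xsp * Xi => q p.1 p.2).
Hypothesis xi_id : forall i B, measurable B ->
  distribution P (xi i) B = distribution P (xi 0%N) B.
Hypothesis Xt_xi_indep : forall j k i i' B1 B2 C C', i != i' ->
  measurable B1 -> measurable B2 -> measurable C -> measurable C' ->
  P ((Xt j @^-1` B1 `&` Xt k @^-1` B2) `&` (xi i @^-1` C `&` xi i' @^-1` C'))
  = (P (Xt j @^-1` B1 `&` Xt k @^-1` B2)
     * (P (xi i @^-1` C) * P (xi i' @^-1` C')))%E.
Hypothesis Xt_indep : forall j k B1 B2, j != k ->
  measurable B1 -> measurable B2 ->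
  P (Xt j @^-1` B1 `&` Xt k @^-1` B2)
  = (P (Xt j @^-1` B1) * P (Xt k @^-1` B2))%E.

Let Q i w x := q x (xi i w).
Let th j w := theta P Q (Xt j w).
Let vb t j w := vote_avg R Q t w (Xt j w).

Let mth j : measurable_fun setT (th j).
Proof. exact: (measurableT_comp (measurable_theta mq xi_id)). Qed.

Let bth j : bounded_mfun (th j).
Proof. exact: (bounded_mfun_comp (bounded_theta mq xi_id)). Qed.

Let bvb t j : bounded_mfun (vb t j).
Proof. exact: bounded_vote_avg. Qed.

Lemma Exp_pair_event j k (phi psi : Xsp -> bool) : j != k ->
  measurable_fun setT phi -> measurable_fun setT psi ->
  \int[P]_w (phi (Xt j w) && psi (Xt k w))%:R
  = \int[P]_w (phi (Xt j w))%:R * \int[P]_w (psi (Xt k w))%:R.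
Proof.
move=> jk mphi mpsi.
have mphiX : measurable_fun setT (fun w => phi (Xt j w)).
  exact: (measurableT_comp mphi).
have mpsiX : measurable_fun setT (fun w => psi (Xt k w)).
  exact: (measurableT_comp mpsi).
rewrite !Exp_bool//; last exact: measurable_and.
have mS (b : Xsp -> bool) : measurable_fun setT b -> measurable [set x | b x].
  by move=> mb; have := mb measurableT [set true] I; rewrite setTI.
rewrite -fineM; last 2 first.
- by apply: fin_num_measure; have := measurable_funPTI (Xt j) (mS _ mphi).
- by apply: fin_num_measure; have := measurable_funPTI (Xt k) (mS _ mpsi).
congr fine; rewrite -(Xt_indep jk (mS _ mphi) (mS _ mpsi)); congr (P _).
by apply/seteqP; split => w /=; [move=> /andP[]|move=> [-> ->]].
Qed.

Lemma Exp_vote_avg_sqr_pair t j k (phi : Xsp -> bool) (psi : Xsp -> bool) :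
  (0 < t)%N -> measurable_fun setT phi -> measurable_fun setT psi ->
  \int[P]_w ((phi (Xt j w) && psi (Xt k w))%:R * (vb t j w - th j w) ^+ 2)
  <= t%:R^-1 * \int[P]_w (phi (Xt j w) && psi (Xt k w))%:R.
Proof.
move=> t0 mphi mpsi.
apply: (Exp_vote_avg_sqr mq xi_id (Xt_xi_indep j k)
  (phi := fun p => phi p.1 && psi p.2)) => //.
apply: measurable_and.
  exact: (measurableT_comp mphi measurable_fst).
exact: (measurableT_comp mpsi measurable_snd).
Qed.

Lemma Exp_vote_avg_sqrT t j : (0 < t)%N ->
  \int[P]_w ((vb t j w - th j w) ^+ 2) <= t%:R^-1.
Proof.
move=> t0; have := @Exp_vote_avg_sqr_pair t j j xpredT xpredT t0.
rewrite /= Exp_cst mulr1 => H; apply: le_trans (H _ _) => //.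
rewrite le_eqVlt; apply/orP; left; apply/eqP.
by apply: eq_Rintegral => w _; rewrite mul1r.
Qed.

Variables (t : nat) (h s C p : R).
Hypotheses (t_gt0 : (0 < t)%N) (m_gt0 : (0 < m)%N) (h_gt0 : 0 < h)
  (s_gt0 : 0 < s) (st : s ^+ 6 = t%:R^-1).
Hypothesis near_C : forall j a, 0 < a ->
  \int[P]_w (near_edge h a (th j w))%:R <= C * a.
Hypothesis win_p : forall j, \int[P]_w (in_window h (th j w))%:R = p.

Let dis j w := in_window h (vb t j w) != in_window h (th j w).

Let mdis j : measurable_fun setT (dis j).
Proof.
have mv : measurable_fun setT (fun w => in_window h (vb t j w)).
  by apply: measurable_in_window; have [] := bvb t j.
have mt : measurable_fun setT (fun w => in_window h (th j w)).
  exact: measurable_in_window.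
have -> : dis j = fun w => (in_window h (vb t j w) && ~~ in_window h (th j w))
    || (~~ in_window h (vb t j w) && in_window h (th j w)).
  by apply/funext => w; rewrite /dis; do 2 case: in_window.
by apply: measurable_or; apply: measurable_and => //; exact: measurable_neg.
Qed.

Let bZ j : bounded_mfun (fun w => (vb t j w - th j w) ^+ 2).
Proof. by apply: bounded_mfunX; exact: bounded_mfunB. Qed.

(** The scale [s ^+ 2] balances the two ways of disagreeing: the probability of
    being this close to an edge has order [s ^+ 2], and Chebyshev's inequality
    beyond it gives [s ^+ 6 / s ^+ 4]. *)
Lemma Exp_disagree_le j : \int[P]_w (dis j w)%:R <= (C + 1) * s ^+ 2.
Proof.
have s2 : 0 < s ^+ 2 by rewrite exprn_gt0.
have bn : bounded_mfun (fun w => (near_edge h (s ^+ 2) (th j w))%:R : R).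
  by apply: bounded_mfun_bool; exact: measurable_near_edge.
apply: (@le_trans _ _ (\int[P]_w ((near_edge h (s ^+ 2) (th j w))%:R
    + (s ^+ 2) ^- 2 * (vb t j w - th j w) ^+ 2))).
  apply: le_Exp.
  - exact: bounded_mfun_bool.
  - apply: bounded_mfunD => //; apply: bounded_mfunM => //.
    exact: bounded_mfun_cst.
  - move=> w; apply: bool_le_chebyshev => //; exact: window_disagree.
rewrite ExpD//; last by apply: bounded_mfunM => //; exact: bounded_mfun_cst.
rewrite ExpZ// mulrDl mul1r lerD ?near_C//.
apply: (@le_trans _ _ ((s ^+ 2) ^- 2 * t%:R^-1)).
  by rewrite ler_wpM2l ?invr_ge0 ?sqr_ge0// Exp_vote_avg_sqrT.
rewrite -st le_eqVlt; apply/orP; left; apply/eqP; field; rewrite gt_eqF//.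
Qed.

(** With [a1 = s ^+ 2] and [a2 = s] the three scales contribute
    [C ^+ 2 * s ^+ 4], twice [C ^+ 2 * s ^+ 2 * (s ^+ 6 / s ^+ 4)] and twice
    [s ^+ 6 / s ^+ 2]. *)
Lemma Exp_two_disagree_le j k : j != k ->
  \int[P]_w ((dis j w)%:R * (dis k w)%:R) <= (3 * C ^+ 2 + 2) * s ^+ 4.
Proof.
move=> jk.
have s2 : 0 < s ^+ 2 by rewrite exprn_gt0.
have mnx a : measurable_fun setT (fun x => near_edge h a (theta P Q x)).
  by apply: measurable_near_edge; exact: measurable_theta.
have mn a i : measurable_fun setT (fun w => near_edge h a (th i w)).
  exact: measurable_near_edge.
have bnn a i i' : bounded_mfun (fun w =>
    (near_edge h a (th i w) && near_edge h a (th i' w))%:R : R).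
  by apply: bounded_mfun_bool; exact: measurable_and.
have bnnZ a i i' : bounded_mfun (fun w =>
    (near_edge h a (th i w) && near_edge h a (th i' w))%:R
    * (vb t i w - th i w) ^+ 2).
  exact: bounded_mfunM.
have bc c F : bounded_mfun F -> bounded_mfun (fun w : Omega => c * F w : R).
  by move=> bF; apply: bounded_mfunM => //; exact: bounded_mfun_cst.
have Enn a i i' : 0 < a -> i != i' -> \int[P]_w
    (near_edge h a (th i w) && near_edge h a (th i' w))%:R <= C ^+ 2 * a ^+ 2.
  move=> a0 ii'.
  rewrite (@Exp_pair_event i i' (fun x => near_edge h a (theta P Q x))
     (fun x => near_edge h a (theta P Q x)))// -exprMn expr2.
  by apply: ler_pM; rewrite ?Rintegral_ge0 ?near_C//.
have EnnZ a i i' : 0 < a -> i != i' -> \int[P]_w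
    ((near_edge h a (th i w) && near_edge h a (th i' w))%:R
      * (vb t i w - th i w) ^+ 2) <= s ^+ 6 * (C ^+ 2 * a ^+ 2).
  move=> a0 ii'; rewrite st.
  apply: le_trans (@Exp_vote_avg_sqr_pair t i i'
    (fun x => near_edge h a (theta P Q x))
    (fun x => near_edge h a (theta P Q x)) t_gt0 (mnx a) (mnx a)) _.
  by rewrite ler_wpM2l ?invr_ge0// Enn.
apply: (@le_trans _ _ (\int[P]_w
  ((near_edge h (s ^+ 2) (th j w) && near_edge h (s ^+ 2) (th k w))%:R
  + (s ^+ 2) ^- 2 * ((near_edge h s (th j w) && near_edge h s (th k w))%:R
      * (vb t j w - th j w) ^+ 2)
  + (s ^+ 2) ^- 2 * ((near_edge h s (th k w) && near_edge h s (th j w))%:R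
      * (vb t k w - th k w) ^+ 2)
  + (s ^- 2 * (vb t j w - th j w) ^+ 2 + s ^- 2 * (vb t k w - th k w) ^+ 2)))).
  apply: le_Exp.
  - by apply: bounded_mfunM; exact: bounded_mfun_bool.
  - apply: bounded_mfunD; last by apply: bounded_mfunD; exact: bc.
    by apply: bounded_mfunD; [apply: bounded_mfunD|]; rewrite //; exact: bc.
  - by move=> w; rewrite -natrM mulnb; exact: two_disagreements_le.
rewrite ExpD; last 2 first.
- by apply: bounded_mfunD; [apply: bounded_mfunD|]; rewrite //; exact: bc.
- by apply: bounded_mfunD; exact: bc.
rewrite ExpD; last 2 first.
- by apply: bounded_mfunD => //; exact: bc.
- exact: bc.
rewrite ExpD//; last exact: bc.
rewrite (ExpD _ (bc _ _ (bZ j)) (bc _ _ (bZ k))).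
rewrite !ExpZ//.
have H1 := Enn _ _ _ s2 jk.
have si : (s ^+ 2) ^- 2 >= 0 by rewrite invr_ge0 sqr_ge0.
have si2 : s ^- 2 >= 0 by rewrite invr_ge0 sqr_ge0.
have kj : k != j by rewrite eq_sym.
have H2 := ler_wpM2l si (EnnZ _ _ _ s_gt0 jk).
have H3 := ler_wpM2l si (EnnZ _ _ _ s_gt0 kj).
have H4 := ler_wpM2l si2 (Exp_vote_avg_sqrT j t_gt0).
have H5 := ler_wpM2l si2 (Exp_vote_avg_sqrT k t_gt0).
apply: le_trans (lerD (lerD (lerD H1 H2) H3) (lerD H4 H5)) _.
rewrite -st le_eqVlt; apply/orP; left; apply/eqP; field; rewrite gt_eqF//.
Qed.

Lemma bounded_holdout_error (f0 : R) : bounded_mfun (fun w =>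
  (holdout_estimator (@rect_kernel R) h Q t Xt w - f0) ^+ 2).
Proof.
apply: bounded_mfunX; apply: bounded_mfunB; last exact: bounded_mfun_cst.
apply: bounded_mfunM; first exact: bounded_mfun_cst.
apply: bounded_mfun_sum => j.
under eq_fun do rewrite rect_kernel_window//.
apply: bounded_mfunM; first exact: bounded_mfun_cst.
apply: bounded_mfun_bool; apply: measurable_in_window.
by have [] := bvb t j.
Qed.

(** The error splits into three parts: the effect [D] of replacing [theta] by
    the vote average, the fluctuation [S] of the oracle around its mean, and its
    bias.  Their squares are summed with the factor [3]. *)
Lemma holdout_mse_le (f0 : R) :
  \int[P]_w ((holdout_estimator (@rect_kernel R) h Q t Xt w - f0) ^+ 2)
  <= 3 * ((4 * h ^+ 2)^-1
          * ((3 * C ^+ 2 + 2) * s ^+ 4 + (C + 1) * s ^+ 2 / m%:R)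
          + (4 * h ^+ 2)^-1 * (p / m%:R) + (p / (2 * h) - f0) ^+ 2).
Proof.
have mR : 0 < (m%:R : R) by rewrite ltr0n.
pose a j w : R := (in_window h (th j w))%:R.
pose D j w : R := (in_window h (vb t j w))%:R - a j w.
pose S j w : R := a j w - p.
have ba j : bounded_mfun (a j).
  by apply: bounded_mfun_bool; exact: measurable_in_window.
have bD j : bounded_mfun (D j).
  apply: bounded_mfunB => //; apply: bounded_mfun_bool.
  by apply: measurable_in_window; have [] := bvb t j.
have bS j : bounded_mfun (S j).
  by apply: bounded_mfunB => //; exact: bounded_mfun_cst.
have bsD : bounded_mfun (fun w => (\sum_(j < m) D j w) ^+ 2).
  by apply: bounded_mfunX; exact: bounded_mfun_sum.
have bsS : bounded_mfun (fun w => (\sum_(j < m) S j w) ^+ 2).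
  by apply: bounded_mfunX; exact: bounded_mfun_sum.
have estE w : holdout_estimator (@rect_kernel R) h Q t Xt w - f0 =
    (2 * m%:R * h)^-1 * (\sum_(j < m) D j w)
    + (2 * m%:R * h)^-1 * (\sum_(j < m) S j w) + (p / (2 * h) - f0).
  rewrite /holdout_estimator.
  under eq_bigr do rewrite rect_kernel_window//.
  rewrite -mulr_sumr !sumrB sumr_const card_ord -[p *+ m]mulr_natr.
  by rewrite /a /vb /th; field; rewrite !gt_eqF.
set c := (2 * m%:R * h)^-1 in estE.
have bc F e : bounded_mfun F -> bounded_mfun (fun w : Omega => e * F w : R).
  by move=> bF; apply: bounded_mfunM => //; exact: bounded_mfun_cst.
have pw w : (holdout_estimator (@rect_kernel R) h Q t Xt w - f0) ^+ 2 <=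
    3 * (c ^+ 2 * (\sum_(j < m) D j w) ^+ 2
         + c ^+ 2 * (\sum_(j < m) S j w) ^+ 2 + (p / (2 * h) - f0) ^+ 2).
  rewrite estE -!exprMn.
  move: (c * _) (c * _) (_ - f0) => x y z.
  have := sqr_ge0 (x - y); have := sqr_ge0 (y - z); have := sqr_ge0 (x - z).
  lra.
have bE := bounded_holdout_error f0.
have bR : bounded_mfun (fun w => c ^+ 2 * (\sum_(j < m) D j w) ^+ 2
         + c ^+ 2 * (\sum_(j < m) S j w) ^+ 2).
  by apply: bounded_mfunD; exact: bc.
apply: le_trans (le_Exp P bE _ pw) _.
  by apply: bc; apply: bounded_mfunD => //; exact: bounded_mfun_cst.
rewrite ExpZ; last by apply: bounded_mfunD => //; exact: bounded_mfun_cst.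
rewrite ler_pM2l; last lra.
rewrite ExpD//; last exact: bounded_mfun_cst.
rewrite Exp_cst lerD2r ExpD//; try exact: bc.
rewrite !ExpZ//.
have c0 : 0 <= c ^+ 2 by rewrite sqr_ge0.
have absD j w : D j w = (dis j w)%:R \/ D j w = - (dis j w)%:R.
  rewrite /D /a /dis.
  case: (in_window h (vb t j w)); case: (in_window h (th j w));
  rewrite /= ?subrr ?subr0 ?sub0r; by [left|right].
have EDD : \int[P]_w ((\sum_(j < m) D j w) ^+ 2) <=
    m%:R ^+ 2 * ((3 * C ^+ 2 + 2) * s ^+ 4) + m%:R * ((C + 1) * s ^+ 2).
  apply: Exp_sqr_sum_le => //.
  - move=> j k jk; apply: le_trans (Exp_two_disagree_le jk).
    apply: le_Exp; first exact: bounded_mfunM.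
      by apply: bounded_mfunM; exact: bounded_mfun_bool.
    move=> w; case: (absD j w) => ->; case: (absD k w) => ->;
    case: (dis j w); case: (dis k w); rewrite /=; lra.
  - move=> j; apply: le_trans (Exp_disagree_le j).
    apply: le_Exp; [exact: bounded_mfunX|exact: bounded_mfun_bool|].
    by move=> w; case: (absD j w) => ->; case: (dis j w);
       rewrite /= ?sqrrN ?expr1n ?expr0n.
  - apply: mulr_ge0; last by rewrite exprn_ge0// ltW.
    have := sqr_ge0 C; lra.
have ESS : \int[P]_w ((\sum_(j < m) S j w) ^+ 2) <= m%:R ^+ 2 * 0 + m%:R * p.
  apply: Exp_sqr_sum_le => //.
  - move=> j k jk; rewrite le_eqVlt; apply/orP; left; apply/eqP.
    have -> : (fun w => S j w * S k w) =
        (fun w => a j w * a k w + (- p * a j w + (- p * a k w + p ^+ 2))).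
      by apply/funext => w; rewrite /S; ring.
    have baa : bounded_mfun (fun w => a j w * a k w) by exact: bounded_mfunM.
    have b1 : bounded_mfun (fun w => - p * a k w + p ^+ 2).
      by apply: bounded_mfunD; [exact: bc|exact: bounded_mfun_cst].
    have b2 : bounded_mfun (fun w => - p * a j w + (- p * a k w + p ^+ 2)).
      by apply: bounded_mfunD => //; exact: bc.
    rewrite ExpD// ExpD//; last exact: bc.
    rewrite ExpD//; [|exact: bc|exact: bounded_mfun_cst].
    rewrite Exp_cst !ExpZ// /a !win_p.
    have -> : \int[P]_w ((in_window h (th j w))%:R * (in_window h (th k w))%:R)
        = p * p :> R.
      rewrite -{1}(win_p j) -(win_p k).
      have mwx : measurable_fun setT (fun x => in_window h (theta P Q x)).
        by apply: measurable_in_window; exact: measurable_theta.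
      rewrite -(@Exp_pair_event j k (fun x => in_window h (theta P Q x))
        (fun x => in_window h (theta P Q x)))//.
      by apply: eq_Rintegral => w _; rewrite -natrM mulnb.
    ring.
  - move=> j.
    have p0 : 0 <= p by rewrite -(win_p j) Rintegral_ge0.
    have -> : (fun w => S j w ^+ 2) = (fun w => (1 - 2 * p) * a j w + p ^+ 2).
      apply/funext => w; rewrite /S /a.
      by case: (in_window _ _); rewrite /=; ring.
    rewrite ExpD; [|exact: bc|exact: bounded_mfun_cst].
    rewrite Exp_cst ExpZ// /a win_p; nra.
apply: le_trans (lerD (ler_wpM2l c0 EDD) (ler_wpM2l c0 ESS)) _.
by rewrite /c le_eqVlt; apply/orP; left; apply/eqP; field; rewrite !gt_eqF.
Qed.

End MeanSquaredError.

(** * Probability of the neighbourhood of the edges *)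

Section EdgeProbability.
Context (R : realType) (d : measure_display) (Omega : measurableType d)
  (P : probability Omega R).
Variables (mu : set R -> \bar R) (f : R -> R) (F : Omega -> R).
Hypotheses (mu_f : has_density01 mu f) (mF : measurable_fun setT F).
Hypothesis F_mu : forall S, measurable S -> P (F @^-1` S) = mu S.
Variables (delta M : R).
Hypotheses (delta_gt0 : 0 < delta) (delta_lt : delta < 2^-1).
Hypothesis f_M : forall s, 2^-1 - delta <= s <= 2^-1 + delta -> f s <= M.

Lemma Exp_in_window h :
  \int[P]_w (in_window h (F w))%:R = fine (mu `[2^-1 - h, 2^-1 + h]%classic).
Proof.
rewrite Exp_bool; last exact: measurable_in_window.
rewrite -F_mu//; congr (fine (P _)); apply/seteqP.
by split => w; rewrite /in_window /= in_itv/= ler_norml => H; lra.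
Qed.

Lemma itv_prob_le a b : 2^-1 - delta <= a -> a <= b -> b <= 2^-1 + delta ->
  fine (mu `[a, b]%classic) <= M * (b - a).
Proof.
move=> a1 ab b1; rewrite -lee_fin fineK; last first.
  rewrite -F_mu//; apply: fin_num_measure.
  by have := mF measurableT (measurable_itv `[a, b]); rewrite setTI.
have dl := delta_lt; apply: (density_itv_le mu_f) => //; first lra; first lra.
by move=> s; rewrite in_itv/= => /andP[sa sb]; apply: f_M; lra.
Qed.

(** For [a <= delta / 2] the two intervals around the edges lie in the
    neighbourhood where the density is bounded by [M]; for larger [a] the term
    [2 / delta * a] exceeds [1]. *)
Lemma Exp_near_edge_le h a : 0 < h -> h <= delta / 2 -> 0 < a -> 0 <= M ->
  \int[P]_w (near_edge h a (F w))%:R <= (4 * M + 2 / delta) * a.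
Proof.
move=> h0 hd a0 M0; have d0 := delta_gt0.
have mn : measurable_fun setT (fun w => near_edge h a (F w)).
  exact: measurable_near_edge.
have [ad|da] := leP a (delta / 2); last first.
  apply: (@le_trans _ _ 1).
    rewrite -[leRHS](Exp_cst P); apply: le_Exp.
    - exact: bounded_mfun_bool.
    - exact: bounded_mfun_cst.
    - by move=> w; case: near_edge.
  have : 1 <= 2 / delta * a.
    by rewrite mulrAC ler_pdivlMr// mul1r; lra.
  have := mulr_ge0 M0 (ltW a0); lra.
pose b1 w := F w \in `[2^-1 - h - a, 2^-1 - h + a].
pose b2 w := F w \in `[2^-1 + h - a, 2^-1 + h + a].
have mb c e : measurable_fun setT (fun w => F w \in `[c, e]).
  apply: (measurable_fun_bool true); rewrite setTI.
  rewrite [X in measurable X](_ : _ = F @^-1` `[c, e]%classic).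
    by have := mF measurableT (measurable_itv `[c, e]); rewrite setTI.
  by apply/seteqP; split => w.
have Eb c e : \int[P]_w (F w \in `[c, e])%:R = fine (mu `[c, e]%classic).
  by rewrite Exp_bool// -F_mu.
apply: (@le_trans _ _ (\int[P]_w ((b1 w)%:R + (b2 w)%:R))).
  apply: le_Exp; first exact: bounded_mfun_bool.
    by apply: bounded_mfunD; apply: bounded_mfun_bool; exact: mb.
  move=> w; rewrite /near_edge.
  case: (ltP `| `|2^-1 - F w| - h| a) => [|_]; last by rewrite addr_ge0.
  rewrite ltr_norml => /andP[H1 H2].
  have [c|c] := leP 0 (2^-1 - F w).
    move: H1 H2; rewrite ger0_norm// => H1 H2.
    have -> : b1 w by rewrite /b1 in_itv/=; apply/andP; split; lra.
    by rewrite lerDl.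
  move: H1 H2; rewrite ltr0_norm// => H1 H2.
  have -> : b2 w by rewrite /b2 in_itv/=; apply/andP; split; lra.
  by rewrite lerDr.
rewrite ExpD; last 2 first.
- exact: bounded_mfun_bool (mb _ _).
- exact: bounded_mfun_bool (mb _ _).
rewrite !Eb.
have := itv_prob_le (a := 2^-1 - h - a) (b := 2^-1 - h + a)
  ltac:(lra) ltac:(lra) ltac:(lra).
have := itv_prob_le (a := 2^-1 + h - a) (b := 2^-1 + h + a)
  ltac:(lra) ltac:(lra) ltac:(lra).
have : 0 <= 2 / delta * a by rewrite mulr_ge0 ?divr_ge0 ?ltW.
lra.
Qed.

End EdgeProbability.

(** * Rate of convergence *)

Section Rates.
Context (R : realType).

Lemma rate_scale_ge1 (m t : nat) : (0 < m)%N -> (0 < t)%N ->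
  1 <= rate_scale R m t.
Proof.
move=> m0 t0; rewrite /rate_scale le_min ler1n m0/=.
by rewrite -[leLHS]sqrtr1 ler_sqrt// ler1n.
Qed.

Lemma powR_ratio_nat (x : R) (j k : nat) : 0 < x -> (0 < k)%N ->
  x `^ (- (j%:R / k%:R)) = (x `^ (- (1 / k%:R))) ^+ j.
Proof.
by move=> x0 k0; rewrite -powR_mulrn ?powR_ge0// -powRrM; congr (_ `^ _); ring.
Qed.

Lemma powR_root_nat (x : R) (k : nat) : 0 < x -> (0 < k)%N ->
  (x `^ (- (1 / k%:R))) ^+ k = x^-1.
Proof.
move=> x0 k0; rewrite -powR_ratio_nat// divff ?pnatr_eq0 -?lt0n//.
by rewrite powR_inv1 ?ltW.
Qed.

(** Here [z] is the bandwidth up to a constant.  The last three bounds come from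
    [m^-1 <= N^-1], [t `^ (- (2 / 3)) <= N `^ (- (4 / 3))] and
    [t `^ (- (1 / 3)) / m <= N `^ (- (5 / 3))]; in the last two, the power of [N]
    is in turn at most [z ^+ (2 * beta + 2)] since [z <= 1] and [beta >= 1].
    Raising to integer powers reduces everything to [N <= m] and
    [N ^+ 2 <= t]. *)
Lemma rate_comparison (m t beta : nat) (z s : R) :
  (0 < m)%N -> (0 < t)%N -> (0 < beta)%N -> 0 < z -> 0 < s ->
  z ^+ (2 * beta + 1) = (rate_scale R m t)^-1 -> s ^+ 6 = t%:R^-1 ->
  [/\ z <= 1, (m%:R)^-1 <= z ^+ (2 * beta + 1),
      s ^+ 4 <= z ^+ (2 * beta + 2) & s ^+ 2 / m%:R <= z ^+ (2 * beta + 2)].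
Proof.
move=> m0 t0 beta0 z0 s0 zE sE.
have N1 := rate_scale_ge1 m0 t0; set N := rate_scale R m t in zE N1.
have N0 : 0 < N by lra.
have mR : 0 < (m%:R : R) by rewrite ltr0n.
have tR : 0 < (t%:R : R) by rewrite ltr0n.
have z1 : z <= 1.
  rewrite leNgt; apply/negP => z1.
  have : 1 < z ^+ (2 * beta + 1) by rewrite exprn_egt1// addn1.
  by rewrite zE ltNge invf_le1// N1.
have zle i j : (j <= i)%N -> z ^+ i <= z ^+ j.
  by move=> ij; rewrite ler_wiXn2l// ltW.
have Nm : m%:R^-1 <= z ^+ (2 * beta + 1).
  by rewrite zE lef_pV2// /N /rate_scale ge_min lexx.
have Nt : s ^+ 6 <= z ^+ (2 * (2 * beta + 1)).
  rewrite sE mulnC exprM zE exprVn lef_pV2 ?posrE ?exprn_gt0//.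
  rewrite -[leRHS]sqr_sqrtr ?ler0n// ler_pXn2r ?nnegrE ?sqrtr_ge0//; last lra.
  by rewrite /N /rate_scale ge_min lexx orbT.
have s4 : s ^+ 4 <= z ^+ (2 * beta + 2).
  rewrite -(@ler_pXn2r _ 3) ?nnegrE ?exprn_ge0 ?(ltW s0) ?(ltW z0)// -!exprM.
  rewrite -[(4 * 3)%N]/(6 * 2)%N exprM.
  apply: (@le_trans _ _ (z ^+ (2 * (2 * beta + 1)) ^+ 2)).
    by rewrite ler_pXn2r ?nnegrE ?exprn_ge0 ?(ltW s0) ?(ltW z0).
  rewrite -exprM; apply: zle; lia.
split => //.
have s2 : s ^+ 2 <= z.
  rewrite -(@ler_pXn2r _ 3) ?nnegrE ?exprn_ge0 ?(ltW s0) ?(ltW z0)// -exprM.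
  apply: le_trans Nt _; apply: zle; lia.
have -> : z ^+ (2 * beta + 2) = z * z ^+ (2 * beta + 1).
  by rewrite -exprS; congr (_ ^+ _); lia.
by apply: ler_pM => //; rewrite ?exprn_ge0 ?invr_ge0 ?(ltW s0) ?(ltW mR).
Qed.

End Rates.

Section HoldoutRate.
Context (R : realType) (d : measure_display) (Omega : measurableType d)
  (P : probability Omega R)
  (dX : measure_display) (Xsp : measurableType dX)
  (dXi : measure_display) (Xi : measurableType dXi)
  (X : {RV P >-> Xsp}) (Y : {RV P >-> bool})
  (q : Xsp -> Xi -> bool) (xi : nat -> {RV P >-> Xi}).

(** The hypothesis on [beta] is a Taylor expansion of [f] at one half with
    remainder of order [h ^+ beta].  Since the scale is at least [1], the choice
    [c1 = delta / 2] makes every bandwidth at most [delta / 2], so that the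
    windows stay away from the boundary of the neighbourhood on which the
    density is controlled. *)
Lemma holdout_rate (l : bool) (f : R -> R) (delta M kappa : R) (beta : nat) :
  let Q := fun i w x => q x (xi i w) in
  measurable_fun setT (fun p : Xsp * Xi => q p.1 p.2) ->
  (forall i B, measurable B ->
    distribution P (xi i) B = distribution P (xi 0%N) B) ->
  has_density01
    (fun B => cond_prob P ((theta P Q \o X) @^-1` B) (Y @^-1` [set l])) f ->
  0 < delta < 2^-1 -> (0 < beta)%N ->
  (forall s, 2^-1 - delta <= s <= 2^-1 + delta -> f s <= M) ->
  (forall h, 0 < h -> h <= delta ->
   exists B, forall s, s \in `[2^-1 - h, 2^-1 + h] ->
     `|f s - (f 2^-1 + B * (s - 2^-1))| <= kappa * h ^+ beta) ->
  exists c1 c2 : R, [/\ 0 < c1, 0 < c2 &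
     forall (m t : nat) (Xt : 'I_m -> {RV P >-> Xsp}) (h : R),
       (0 < m)%N -> odd t -> holdout_sample X Y xi l Xt ->
       h = c1 * rate_scale R m t `^ (- (1 / (2 * beta + 1)%:R)) ->
       h < delta ->
       ('E_P[fun w => ((holdout_estimator (@rect_kernel R) h Q t Xt w
                        - f 2^-1) ^+ 2)%R]
        <= (c2 * rate_scale R m t
              `^ (- ((2 * beta)%:R / (2 * beta + 1)%:R)))%:E)%E].
Proof.
move=> Q mq xi_id hf /andP[d0 d1] beta0 fM bias.
have hM : f 2^-1 <= M by apply: fM; lra.
have M0 : 0 <= M.
  by have [_ f0 _] := hf; apply: le_trans hM; apply: f0; lra.
pose c1 := delta / 2; have c10 : 0 < c1 by rewrite /c1; lra.
pose C := 4 * M + 2 / delta.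
have C0 : 0 <= C by apply: addr_ge0; [rewrite mulr_ge0|rewrite divr_ge0// ltW].
pose c2 := 3 * ((4 * c1 ^+ 2)^-1 * (3 * C ^+ 2 + 2 + (C + 1)) + M / (2 * c1)
   + kappa ^+ 2 * c1 ^+ (2 * beta)).
exists c1, c2; split => //.
  have e1 : 0 < (4 * c1 ^+ 2)^-1 * (3 * C ^+ 2 + 2 + (C + 1)).
    rewrite mulr_gt0 ?invr_gt0 ?mulr_gt0 ?exprn_gt0//.
    by have := sqr_ge0 C; lra.
  have e2 : 0 <= M / (2 * c1) by apply: divr_ge0 => //; lra.
  have e3 : 0 <= kappa ^+ 2 * c1 ^+ (2 * beta).
    by apply: mulr_ge0; [exact: sqr_ge0|apply: exprn_ge0; lra].
  by rewrite /c2; lra.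
move=> m t Xt h m0 oddt [Xlaw Xindep _] hE _.
have t0 : (0 < t)%N by case: t oddt {hE}.
have mR : 0 < (m%:R : R) by rewrite ltr0n.
have tR : 0 < (t%:R : R) by rewrite ltr0n.
have N1 := @rate_scale_ge1 R m t m0 t0.
set N := rate_scale R m t in hE N1 *.
have N0 : 0 < N by lra.
have k0 : (0 < 2 * beta + 1)%N by rewrite addn1.
set z := N `^ (- (1 / (2 * beta + 1)%:R)) in hE.
have z0 : 0 < z by rewrite powR_gt0.
have zE : z ^+ (2 * beta + 1) = N^-1 by exact: powR_root_nat.
pose s : R := t%:R `^ (- (1 / 6%:R)).
have s0 : 0 < s by rewrite powR_gt0.
have sE : s ^+ 6 = t%:R^-1 by exact: powR_root_nat.
have [z1 mz s4 s2] := rate_comparison m0 t0 beta0 z0 s0 zE sE.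
have h0 : 0 < h by rewrite hE mulr_gt0.
have hd : h <= delta / 2 by rewrite hE ler_piMr// ltW.
rewrite powR_ratio_nat// -/z.
have mth := measurable_theta mq xi_id.
set mu := (fun B => cond_prob P _ _) in hf.
have law j S : measurable S ->
    P ((fun w => theta P Q (Xt j w)) @^-1` S) = mu S.
  move=> mS; rewrite /mu; have := Xlaw j ((theta P Q) @^-1` S).
  rewrite /distribution /pushforward => <-//.
  by have := mth measurableT S mS; rewrite setTI.
have mF j : measurable_fun setT (fun w => theta P Q (Xt j w)).
  exact: (measurableT_comp mth).
pose p := fine (mu `[2^-1 - h, 2^-1 + h]%classic).
have near_C j a : 0 < a ->
    \int[P]_w (near_edge h a (theta P Q (Xt j w)))%:R <= C * a.
  by move=> a0; apply: (Exp_near_edge_le hf (mF j) (law j) d0 d1 fM).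
have win_p j : \int[P]_w (in_window h (theta P Q (Xt j w)))%:R = p.
  exact: (Exp_in_window (mF j) (law j)).
have p_le : p <= M * (2 * h).
  have := itv_prob_le hf (mF (Ordinal m0)) (law _) d1 fM
     (a := 2^-1 - h) (b := 2^-1 + h) ltac:(lra) ltac:(lra) ltac:(lra).
  by rewrite /p; lra.
have bias_le : `|p / (2 * h) - f 2^-1| <= kappa * h ^+ beta.
  have [B HB] := bias h h0 ltac:(lra).
  by apply: (density_window hf h0 _ _ HB); lra.
have mse := holdout_mse_le mq xi_id (points_votes_product Xindep)
  (points_indep Xindep) t0 m0 h0 s0 sE near_C win_p (f 2^-1).
have bE : bounded_mfun (fun w =>
    (holdout_estimator (@rect_kernel R) h Q t Xt w - f 2^-1) ^+ 2).
  exact: bounded_holdout_error.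
rewrite expectation_bounded// lee_fin; apply: le_trans mse _.
rewrite /c2 -[leRHS]mulrA ler_pM2l; last lra.
rewrite [leRHS]mulrDl [X in _ <= X + _]mulrDl.
have zb : 0 < z ^+ (2 * beta) by rewrite exprn_gt0.
have zS : z ^+ (2 * beta + 1) = z ^+ (2 * beta) * z by rewrite addn1 exprSr.
have zS2 : z ^+ (2 * beta + 2) = z ^+ (2 * beta) * z ^+ 2 by rewrite exprD.
(* With [h = c1 * z], each of the three terms is a constant times
   [z ^+ (2 * beta)]. *)
apply: lerD; first apply: lerD.
- have -> : (4 * c1 ^+ 2)^-1 * (3 * C ^+ 2 + 2 + (C + 1)) * z ^+ (2 * beta) =
    (4 * h ^+ 2)^-1 * ((3 * C ^+ 2 + 2) * z ^+ (2 * beta + 2)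
       + (C + 1) * z ^+ (2 * beta + 2)).
    by rewrite hE zS2; field; rewrite !gt_eqF.
  rewrite ler_pM2l ?invr_gt0 ?mulr_gt0 ?exprn_gt0//.
  apply: lerD; first by rewrite ler_wpM2l//; have := sqr_ge0 C; lra.
  by rewrite -mulrA ler_wpM2l// addr_ge0.
- have -> : M / (2 * c1) * z ^+ (2 * beta) =
    (4 * h ^+ 2)^-1 * (M * (2 * h) * z ^+ (2 * beta + 1)).
    by rewrite hE zS; field; rewrite !gt_eqF.
  rewrite ler_pM2l ?invr_gt0 ?mulr_gt0 ?exprn_gt0//.
  by apply: ler_pM => //; rewrite -(win_p (Ordinal m0)) Rintegral_ge0.
- have -> : kappa ^+ 2 * c1 ^+ (2 * beta) * z ^+ (2 * beta) =
    (kappa * h ^+ beta) ^+ 2.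
    by rewrite hE [RHS]exprMn -exprM (mulnC beta) [(c1 * z) ^+ _]exprMn mulrA.
  rewrite -(@real_normK _ (_ - _)) ?num_real// ler_pXn2r ?nnegrE//.
  exact: le_trans bias_le.
Qed.

End HoldoutRate.

Theorem theorem3 (R : realType)
  (d : measure_display) (Omega : measurableType d) (P : probability Omega R)
  (dX : measure_display) (Xsp : measurableType dX)
  (dXi : measure_display) (Xi : measurableType dXi)
  (n : nat) (D : n.-tuple (Xsp * bool))
  (X : {RV P >-> Xsp}) (Y : {RV P >-> bool})
  (xi : nat -> {RV P >-> Xi})
  (hxi_id : forall i B, measurable B ->
     distribution P (xi i) B = distribution P (xi 0%N) B)
  (hxi_indep : mutually_independent P
     (fun i : nat => g_sigma_algebra_preimage (xi i)))
  (hXY_indep : mutually_independent P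
     (join_family
        (fun _ : unit => g_sigma_algebra_preimage (fun w => (X w, Y w)))
        (fun i : nat => g_sigma_algebra_preimage (xi i))))
  (g : Xsp -> n.-tuple (Xsp * bool) -> Xi -> bool)
  (hg : measurable_fun setT (fun p : Xsp * Xi => g p.1 D p.2))
  (Q : nat -> Omega -> Xsp -> bool)
  (hQ : forall i w x, Q i w x = g x D (xi i w))
  (hY : forall l' : bool, (0 < P (Y @^-1` [set l']))%E)
  (f : bool -> R -> R)
  (hf : forall l' : bool,
     has_density01
       (fun B => cond_prob P ((theta P Q \o X) @^-1` B) (Y @^-1` [set l']))
       (f l'))
  (hfLip : forall l' : bool,
     exists2 delta : R, 0 < delta & is_lipschitz_on (half_nbhd delta) (f l'))
  (l : bool) (delta_l : R)
  (hdelta : 0 < delta_l < 2^-1)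
  (hfl : is_lipschitz_on (half_nbhd delta_l) (f l)) :
  (exists c1 c2 : R, [/\ 0 < c1, 0 < c2 &
     forall (m t : nat) (Xt : 'I_m -> {RV P >-> Xsp}) (h : R),
       (0 < m)%N -> odd t -> holdout_sample X Y xi l Xt ->
       h = c1 * rate_scale R m t `^ (- (1 / 3)) ->
       h < delta_l ->
       ('E_P[fun w => ((holdout_estimator (@rect_kernel R) h Q t Xt w
                        - f l 2^-1) ^+ 2)%R]
        <= (c2 * rate_scale R m t `^ (- (2 / 3)))%:E)%E])
  /\
  ((forall s, half_nbhd delta_l s -> derivable (f l) s 1) ->
   is_lipschitz_on (half_nbhd delta_l) (derive1 (f l)) ->
   exists c1 c2 : R, [/\ 0 < c1, 0 < c2 &
     forall (m t : nat) (Xt : 'I_m -> {RV P >-> Xsp}) (h : R),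
       (0 < m)%N -> odd t -> holdout_sample X Y xi l Xt ->
       h = c1 * rate_scale R m t `^ (- (1 / 5)) ->
       h < delta_l ->
       ('E_P[fun w => ((holdout_estimator (@rect_kernel R) h Q t Xt w
                        - f l 2^-1) ^+ 2)%R]
        <= (c2 * rate_scale R m t `^ (- (4 / 5)))%:E)%E]).
Proof.
have QE : Q = fun i w x => g x D (xi i w).
  by apply/funext => i; apply/funext => w; apply/funext => x; exact: hQ.
have hfl01 := hf l; rewrite QE in hfl01 *.
case/andP: (hdelta) => d0 d1.
have [k k0 /lipschitzP kf] := hfl.
have nbhdP s : 2^-1 - delta_l <= s <= 2^-1 + delta_l -> half_nbhd delta_l s.
  by rewrite /half_nbhd /= in_itv.
have half : half_nbhd delta_l (2^-1 : R) by apply: nbhdP; lra.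
have dist_half (h s : R) : s \in `[2^-1 - h, 2^-1 + h] -> `|s - 2^-1| <= h.
  by rewrite in_itv/= ler_norml; lra.
have sub_nbhd (h s : R) : h <= delta_l -> s \in `[2^-1 - h, 2^-1 + h] ->
    2^-1 - delta_l <= s <= 2^-1 + delta_l.
  by move=> hd; rewrite in_itv/=; lra.
have fM s : 2^-1 - delta_l <= s <= 2^-1 + delta_l ->
    f l s <= f l 2^-1 + k * delta_l.
  move=> sI; have := kf _ _ (nbhdP _ sI) half.
  have : k * `|s - 2^-1| <= k * delta_l.
    by rewrite ler_pM2l// dist_half// in_itv.
  by have := ler_norm (f l s - f l 2^-1); lra.
split=> [|df [k' k'0 /lipschitzP kf']].
- apply: (@holdout_rate _ _ _ P _ _ _ _ X Y (fun x e => g x D e) xi l (f l)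
    delta_l (f l 2^-1 + k * delta_l) k 1 hg hxi_id hfl01 hdelta) => //.
  move=> h h0 hd; exists 0 => s sI; rewrite mul0r addr0 expr1.
  apply: le_trans (kf _ _ (nbhdP _ (sub_nbhd h s hd sI)) half) _.
  by rewrite ler_pM2l// dist_half.
- apply: (@holdout_rate _ _ _ P _ _ _ _ X Y (fun x e => g x D e) xi l (f l)
    delta_l (f l 2^-1 + k * delta_l) k' 2 hg hxi_id hfl01 hdelta) => //.
  move=> h h0 hd; exists (derive1 (f l) 2^-1) => s sI.
  apply: le_trans (taylor1_lipschitz (delta := delta_l) (k := k') k'0 _ _ _) _.
  + by move=> x /nbhdP; exact: df.
  + by move=> x /nbhdP xI; exact: kf'.
  + exact: sub_nbhd hd sI.
  + rewrite ler_pM2l// -(@real_normK _ (s - _)) ?num_real//.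
    by rewrite ler_pXn2r ?nnegrE ?(ltW h0)// dist_half.
Qed.
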